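(* Assume $M$ and the SODE $\sigma$ on $M$ are of class $C^\omega$. The holonomy algebra of the Chern connection $\nabla^\sigma$ is contained in $\mathfrak{sl}(n,\mathbb{R})$ (that is, the endomorphisms $\nabla^\sigma_{V_l}\cdots\nabla^\sigma_{V_1}(R^\sigma(X,Y))$, $X,Y,V_1,\dots,V_l\in\mathfrak{X}(M^1)$, $l\in\mathbb{N}$, which span the holonomy algebra, are traceless) if and only if there exists a function $F\in C^\infty(M^0)$ such that $$\sum_{h=1}^n\frac{\partial F^h}{\partial\dot x^h}=\frac{\partial F}{\partial t}+\frac{\partial F}{\partial x^i}\dot x^i .$$ Moreover, this equation means that the volume form $\exp(-F)\,dt\wedge\omega^1\wedge\dots\wedge\omega^n\wedge\varpi^1\wedge\dots\wedge\varpi^n$ is parallel with respect to $\nabla^\sigma$.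
   Context: $M$ is a connected manifold of dimension $n$; $M^0=\mathbb{R}\times M$; $M^r=J^r(\mathbb{R},M)$ is the manifold of $r$-jets of smooth maps $\mathbb{R}\to M$, with projections $p^{rs}\colon M^r\to M^s$. Coordinates $(x^i)$ on $M$ induce coordinates $(t,x^i,\dot x^i)$ on $M^1$ and $(t,x^i,\dot x^i,\ddot x^i)$ on $M^2$; the displayed equation and the volume form are written in such coordinates. $\mathfrak{X}(M^1)$ denotes the vector fields on $M^1$. The summation convention is used. A SODE on $M$ is a section $\sigma\colon M^1\to M^2$ of $p^{21}$; in coordinates $F^i=\ddot x^i\circ\sigma$. Put $X^\sigma=\frac{\partial}{\partial t}+\dot x^i\frac{\partial}{\partial x^i}+F^i\frac{\partial}{\partial\dot x^i}$, $X^\sigma_i=\frac{\partial}{\partial x^i}+\frac12\frac{\partial F^j}{\partial\dot x^i}\frac{\partial}{\partial\dot x^j}$, $\omega^i=dx^i-\dot x^idt$, $\varpi^i=d\dot x^i-F^idt-\frac12\frac{\partial F^i}{\partial\dot x^j}\omega^j$. The Chern connection $\nabla^\sigma$, with curvature tensor $R^\sigma$, is the linear connection on $M^1$ given in every induced coordinate system by $\nabla^\sigma_YX^\sigma=0$ for all $Y$; $\nabla^\sigma_{X^\sigma}X^\sigma_i=-\frac12\frac{\partial F^j}{\partial\dot x^i}X^\sigma_j$, $\nabla^\sigma_{X^\sigma}\frac{\partial}{\partial\dot x^i}=-\frac12\frac{\partial F^j}{\partial\dot x^i}\frac{\partial}{\partial\dot x^j}$; $\nabla^\sigma_{X^\sigma_j}X^\sigma_i=-\frac12\frac{\partial^2F^k}{\partial\dot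 x^i\partial\dot x^j}X^\sigma_k$, $\nabla^\sigma_{X^\sigma_j}\frac{\partial}{\partial\dot x^i}=-\frac12\frac{\partial^2F^k}{\partial\dot x^i\partial\dot x^j}\frac{\partial}{\partial\dot x^k}$; $\nabla^\sigma_{\partial/\partial\dot x^j}X^\sigma_i=0$, $\nabla^\sigma_{\partial/\partial\dot x^j}\frac{\partial}{\partial\dot x^i}=0$. $\nabla^\sigma$ is reducible to the $G$-structure $P^\sigma$ whose local sections are the frames $(X^\sigma,\lambda^i_jX^\sigma_i,\lambda^i_j\,\partial/\partial\dot x^i)$ with $(\lambda^i_j)$ invertible, where $G=\{\mathrm{diag}(1,\Lambda,\Lambda):\Lambda\in Gl(n,\mathbb{R})\}$. The holonomy algebra (taken at a frame of $P^\sigma$) is thus a subalgebra of the Lie algebra of $G$, identified with $\mathfrak{gl}(n,\mathbb{R})$ by $\mathrm{diag}(0,A,A)\leftrightarrow A$.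
   Formalization: F is taken on R×U for each coordinate chart and each open U with star-shaped coordinate image, not on all of M^0: the equation depends on the coordinates, and a global F can fail to exist (M=R^2 minus 0, F^h=b_j ẋ^j ẋ^h/3 with b=dθ has traceless holonomy but no F). *)

(* Defs.v *)
(* Mathematical Components / MathComp-Analysis. *)
From HB Require Import structures.
From mathcomp Require Import all_boot all_order all_algebra.
From mathcomp Require Import all_classical all_reals all_analysis.
Import Order.TTheory GRing.Theory Num.Theory numFieldNormedType.Exports.

Set Implicit Arguments.
Unset Strict Implicit.
Unset Printing Implicit Defensive.

Local Open Scope classical_set_scope.
Local Open Scope ring_scope.

Section Calculus.
Context {R : realType} {V W : normedModType R}.

(* [D] is meant to be open and the spaces finite-dimensional; directional
   derivatives in every direction are then the usual partial derivatives. *)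
Fixpoint C_on (k : nat) (D : set V) (f : V -> W) : Prop :=
  (forall x, D x -> {for x, continuous f}) /\
  (if k is k'.+1 then
     forall v, (forall x, D x -> derivable f x v) /\ C_on k' D ('D_v f)
   else True).

Definition smooth_on (D : set V) (f : V -> W) : Prop := forall k, C_on k D f.

(* C^omega: smooth and equal to its Taylor series
   f (p + h) = sum_k (D_h)^k f (p) / k! near each point p. *)
Definition analytic_on (D : set V) (f : V -> W) : Prop :=
  smooth_on D f /\
  forall p, D p -> \forall h \near (0 : V),
    series (fun k : nat => (k`!%:R : R)^-1 *: iter k (fun g => 'D_h g) f p)
      @ \oo --> f (p + h).

Definition star_shaped (S : set V) : Prop :=
  exists2 x0, S x0 &
    forall x (s : R), S x -> 0 <= s <= 1 -> S (x0 + s *: (x - x0)).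

End Calculus.

Section Manifold.
Context {R : realType} {n : nat} {M : topologicalType}.

Record chart := Chart {
  chart_dom : set M;
  chart_coord : M -> 'rV[R]_n;
  chart_param : 'rV[R]_n -> M;
  dom_open : open chart_dom;
  img_open : open (chart_coord @` chart_dom);
  coordK : forall x, chart_dom x -> chart_param (chart_coord x) = x;
  coord_cont : forall x, chart_dom x -> {for x, continuous chart_coord};
  param_cont : forall y, (chart_coord @` chart_dom) y ->
    {for y, continuous chart_param} }.

Definition transition (c d : chart) : 'rV[R]_n -> 'rV[R]_n :=
  chart_coord d \o chart_param c.

Definition analytic_atlas (A : set chart) : Prop :=
  (forall x, exists2 c, A c & chart_dom c x) /\
  (forall c d, A c -> A d ->
     analytic_on (chart_coord c @` (chart_dom c `&` chart_dom d))
       (transition c d)).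

Definition analytic_manifold (A : set chart) : Prop :=
  [/\ hausdorff_space M, @second_countable M & analytic_atlas A].

(* Coordinate representations: (t, x) on M^0 and (t, x, xdot) on M^1. *)
Local Notation E0 := (R * 'rV[R]_n)%type.
Local Notation E1 := (R * 'rV[R]_n * 'rV[R]_n)%type.

Definition dom0 (c : chart) (U : set M) : set E0 :=
  [set q | (chart_coord c @` U) q.2].
Definition dom1 (c : chart) (U : set M) : set E1 :=
  [set p | (chart_coord c @` U) p.1.2].

Section Jets.
Variable A : set chart.

Definition smooth_curve (g : R -> M) : Prop :=
  continuous g /\
  forall c, A c -> smooth_on (g @^-1` chart_dom c) (chart_coord c \o g).

Definition same_jet (r : nat) (t : R) (g h : R -> M) : Prop :=
  g t = h t /\
  forall c, A c -> chart_dom c (g t) -> forall k : nat, (k <= r)%N ->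
    derive1n k (chart_coord c \o g) t = derive1n k (chart_coord c \o h) t.

(* The r-jet at t of g, as an equivalence class of pairs (time, curve). *)
Definition jet_class (r : nat) (t : R) (g : R -> M) : set (R * (R -> M)) :=
  [set q | [/\ q.1 = t, smooth_curve q.2 & same_jet r t g q.2]].

Record jet (r : nat) := Jet {
  jet_set : set (R * (R -> M));
  jetP : exists t g, smooth_curve g /\ jet_set = jet_class r t g }.

(* For s <= r, the projection p^{rs} sends an r-jet J to the unique s-jet whose
   class contains that of J. *)
Definition jet_proj (r s : nat) (J : jet r) (J' : jet s) : Prop :=
  jet_set J `<=` jet_set J'.

Definition is_sode (sigma : jet 1 -> jet 2) : Prop :=
  forall j, jet_proj (sigma j) j.

Definition coord1 (c : chart) (q : R * (R -> M)) : E1 :=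
  (q.1, chart_coord c (q.2 q.1), derive1n 1 (chart_coord c \o q.2) q.1).

Definition coord_xddot (c : chart) (q : R * (R -> M)) : 'rV[R]_n :=
  derive1n 2 (chart_coord c \o q.2) q.1.

(* F^i = xddot^i o sigma, as a function of the coordinates (t, x, xdot); every
   point of [dom1 c (chart_dom c)] is the coordinate expression of a 1-jet, and
   the default value 0 is used only outside that set. *)
Definition sode_coord (sigma : jet 1 -> jet 2) (c : chart) (p : E1)
    : 'rV[R]_n :=
  xget 0 [set w | exists j q,
    [/\ jet_set (sigma j) q, chart_dom c (q.2 q.1), coord1 c q = p
      & coord_xddot c q = w]].

Definition analytic_sode (sigma : jet 1 -> jet 2) : Prop :=
  is_sode sigma /\
  forall c, A c -> analytic_on (dom1 c (chart_dom c)) (sode_coord sigma c).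

(* Change of induced coordinates on M^1. *)
Definition transition1 (c d : chart) (p : E1) : E1 :=
  (p.1.1, transition c d p.1.2, 'D_(p.2) (transition c d) p.1.2).

(* A vector field on M^1, given by its components in the induced coordinate
   systems, which transform by the Jacobian of the change of coordinates. *)
Definition vector_field1 (X : chart -> E1 -> E1) : Prop :=
  (forall c, A c -> smooth_on (dom1 c (chart_dom c)) (X c)) /\
  (forall c d, A c -> A d -> forall p, dom1 c (chart_dom c `&` chart_dom d) p ->
     X d (transition1 c d p) = 'D_(X c p) (transition1 c d) p).

End Jets.

(* In this section everything is expressed in one induced coordinate system, a
   tangent vector at (t, x, xdot) being identified with its components, so that
   a vector field Y acts on functions by Y f (p) = 'D_(Y p) f p. *)
Section ChernConnection.
Variable F : E1 -> 'rV[R]_n.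

Local Notation ev i := (delta_mx 0 i : 'rV[R]_n).

Definition d_xdot {U : normedModType R} (i : 'I_n) (f : E1 -> U) : E1 -> U :=
  'D_((0, 0, ev i) : E1) f.

Definition F_comp (j : 'I_n) (p : E1) : R := F p 0 j.

Definition X_sigma (p : E1) : E1 := (1, p.2, F p).

Definition X_hor (i : 'I_n) (p : E1) : E1 :=
  (0, ev i, 2^-1 *: \sum_j d_xdot i (F_comp j) p *: ev j).

Definition X_ver (i : 'I_n) (p : E1) : E1 := (0, 0, ev i).

Definition omega (i : 'I_n) (p u : E1) : R := u.1.2 0 i - p.2 0 i * u.1.1.

Definition varpi (i : 'I_n) (p u : E1) : R :=
  u.2 0 i - F_comp i p * u.1.1
  - 2^-1 * \sum_j d_xdot j (F_comp i) p * omega j p u.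

(* The frame (X^sigma, X^sigma_i, d/dxdot^i) and its dual coframe
   (dt, omega^i, varpi^i), indexed by 1 + (n + n). *)
Definition frame (a : 'I_(1 + (n + n))) : E1 -> E1 :=
  match fintype.split a with
  | inl _ => X_sigma
  | inr b => match fintype.split b with inl i => X_hor i | inr i => X_ver i end
  end.

Definition coframe (a : 'I_(1 + (n + n))) (p u : E1) : R :=
  match fintype.split a with
  | inl _ => u.1.1
  | inr b =>
      match fintype.split b with
      | inl i => omega i p u
      | inr i => varpi i p u
      end
  end.

(* nabla_{e_b} e_i where e is X_hor or X_ver: the same coefficients occur in
   both cases. *)
Definition nabla_block (e : 'I_n -> E1 -> E1) (b : 'I_(1 + (n + n)))
    (i : 'I_n) (p : E1) : E1 :=
  match fintype.split b with
  | inl _ => - (2^-1 *: \sum_j d_xdot i (F_comp j) p *: e j p)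
  | inr b' =>
      match fintype.split b' with
      | inl j => - (2^-1 *: \sum_k d_xdot i (d_xdot j (F_comp k)) p *: e k p)
      | inr _ => 0
      end
  end.

(* nabla_{e_b} e_a *)
Definition nabla_frame (b a : 'I_(1 + (n + n))) (p : E1) : E1 :=
  match fintype.split a with
  | inl _ => 0
  | inr a' =>
      match fintype.split a' with
      | inl i => nabla_block X_hor b i p
      | inr i => nabla_block X_ver b i p
      end
  end.

(* The linear connection with these values on the frame. *)
Definition nabla (Y Z : E1 -> E1) (p : E1) : E1 :=
  \sum_a ('D_(Y p) (fun q => coframe a q (Z q)) p *: frame a p
          + coframe a p (Z p) *:
              \sum_b coframe b p (Y p) *: nabla_frame b a p).

Definition lie_bracket (X Y : E1 -> E1) (p : E1) : E1 :=
  'D_(X p) Y p - 'D_(Y p) X p.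

Definition curvature (X Y Z : E1 -> E1) (p : E1) : E1 :=
  nabla X (nabla Y Z) p - nabla Y (nabla X Z) p - nabla (lie_bracket X Y) Z p.

(* Covariant derivative of a field T of endomorphisms, seen as an operator on
   vector fields. *)
Definition nabla_end (V : E1 -> E1) (T : (E1 -> E1) -> E1 -> E1)
    (Z : E1 -> E1) (p : E1) : E1 :=
  nabla V (T Z) p - T (nabla V Z) p.

(* For Vs = [:: V_1; V_2; ...; V_l], the field of endomorphisms
   nabla_{V_l} ( ... (nabla_{V_1} (R (X, Y)))). *)
Definition nabla_curvature (Vs : seq (E1 -> E1)) (X Y : E1 -> E1)
    : (E1 -> E1) -> E1 -> E1 :=
  foldl (fun T V => nabla_end V T) (curvature X Y) Vs.

Definition end_mx (T : (E1 -> E1) -> E1 -> E1) (p : E1)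
    : 'M[R]_(1 + (n + n)) :=
  \matrix_(a, b) coframe a p (T (frame b) p).

Variable f : E0 -> R.

(* exp (-f) dt /\ omega^1 /\ ... /\ varpi^n; the wedge product of 1-forms is
   the determinant of their values. *)
Definition volume (p : E1) (u : 'I_(1 + (n + n)) -> E1) : R :=
  expR (- f p.1) * \det (\matrix_(a, b) coframe a p (u b)).

Definition nabla_volume (Y : E1 -> E1) (Z : 'I_(1 + (n + n)) -> E1 -> E1)
    (p : E1) : R :=
  'D_(Y p) (fun q => volume q (fun b => Z b q)) p
  - \sum_a volume p (fun b => if b == a then nabla Y (Z b) p else Z b p).

Definition parallel_volume_on (D : set E1) : Prop :=
  forall Y Z, smooth_on D Y -> (forall b, smooth_on D (Z b)) ->
    forall p, D p -> nabla_volume Y Z p = 0.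

(* The left-hand side is not invariant: a change of coordinates with Jacobian
   matrix J adds 2 d/dt log |det J| to it. A solution f is therefore attached to
   one coordinate system; it is a primitive of a closed 1-form on M^0, which may
   fail to be exact on a coordinate domain with nontrivial topology. *)
Definition divergence_equation_on (D : set E1) : Prop :=
  forall p, D p ->
    \sum_h d_xdot h (F_comp h) p =
    'D_((1, 0) : E0) f p.1 + \sum_i 'D_((0, ev i) : E0) f p.1 * p.2 0 i.

End ChernConnection.

(* The Lie algebra of G, identified with gl(n), and the image of sl(n). *)
Definition gl_embed (L : 'M[R]_n) : 'M[R]_(1 + (n + n)) :=
  block_mx 0 0 0 (block_mx L 0 0 L).

Definition sl_image : set 'M[R]_(1 + (n + n)) :=
  gl_embed @` [set L | \tr L = 0].

(* The holonomy algebra at the frame (X^sigma, X^sigma_i, d/dxdot^i) over the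
   point of M^1 with coordinates p in the system induced by c: the linear span
   of the iterated covariant derivatives of the curvature. *)
Definition holonomy_generator (A : set chart) (sigma : jet A 1 -> jet A 2)
    (c : chart) (p : E1) (B : 'M[R]_(1 + (n + n))) : Prop :=
  exists (Vs : seq (chart -> E1 -> E1)) (X Y : chart -> E1 -> E1),
    [/\ forall k : nat, (k < size Vs)%N ->
          vector_field1 A (nth (fun _ _ => 0) Vs k),
        vector_field1 A X, vector_field1 A Y
      & B = end_mx (sode_coord sigma c)
              (nabla_curvature (sode_coord sigma c)
                 [seq V c | V <- Vs] (X c) (Y c)) p].

Definition holonomy_algebra (A : set chart) (sigma : jet A 1 -> jet A 2)
    (c : chart) (p : E1) : set 'M[R]_(1 + (n + n)) :=
  [set B | exists (k : nat) (a : 'I_k -> R) (E : 'I_k -> 'M[R]_(1 + (n + n))),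
     (forall i, holonomy_generator sigma c p (E i)) /\
     B = \sum_i a i *: E i].

Definition coord0_fun (F : R * M -> R) (c : chart) (q : E0) : R :=
  F (q.1, chart_param c q.2).

(* F is of class C^infty on R x U; U is contained in the domain of c. *)
Definition smooth0_on (F : R * M -> R) (c : chart) (U : set M) : Prop :=
  smooth_on (dom0 c U) (coord0_fun F c).

End Manifold.

Arguments chart R n M : clear implicits.

(* Main.v *)
Require Import Defs.
From HB Require Import structures.
From mathcomp Require Import all_boot all_order all_algebra.
From mathcomp Require Import all_classical all_reals all_analysis.
From mathcomp Require Import perm ring lra.
Import Order.TTheory GRing.Theory Num.Theory numFieldNormedType.Exports.

Set Implicit Arguments.
Unset Strict Implicit.
Unset Printing Implicit Defensive.

Local Open Scope classical_set_scope.
Local Open Scope ring_scope.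

(** Both n-dimensional blocks of the frame, (X^sigma_i) and (d/dxdot^i), are
    transported by one and the same gl(n)-valued connection form A ([conn_mx]),
    and X^sigma is parallel.  Every field of endomorphisms built from the
    curvature therefore has the shape diag (0, B, B): for the curvature itself
    B is dA + A /\ A ([curvature_acts_as]), and covariant differentiation along
    Y replaces B by Y(B) + [A(Y), B] ([nabla_end_acts_as]).  Commutators have no
    trace, so the trace of the curvature is d (tr A) and the trace of a
    covariant derivative is the derivative of the trace.  Being traceless is
    thus a property of d (tr A) alone.

    Let g be the sum of the dF^h/dxdot^h ([divergence]).  Because second partial
    derivatives commute, tr A = - beta / 2 with
      beta = g dt + sum_j (dg/dxdot^j) omega^j
    ([trace_form], [mxtrace_conn_mx]).

    If g = df/dt + (df/dx^i) xdot^i, differentiating in xdot^j gives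
    dg/dxdot^j = df/dx^j, whence beta = df ([trace_form_exact]); then d beta = 0
    and all generators of the holonomy algebra are traceless
    ([divergence_equation_holonomy]).  The equation is only needed near the
    point considered, so a solution over a coordinate ball suffices.

    Conversely, traceless holonomy gives d beta = 0 ([holonomy_closed]).  The
    vector fields that generate the holonomy algebra are globally defined on
    M^1, so vectors that are constant in one coordinate system are first cut off
    by a bump function of the base point and extended by zero
    ([localized_field_vector]).  The components of d beta along
    dxdot^k /\ dx^j say that the functions dg/dxdot^j do not depend on xdot;
    hence g is affine in xdot ([divergence_affine]) and beta is the pull-back of
    a closed 1-form on M^0, which over a star-shaped set has a primitive f
    ([poincare]).  Reading beta = df on X^sigma gives the equation
    ([divergence_equation_solvable]).

    Finally, the derivative of a determinant and tr diag (0, A, A) = - beta show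
    that nabla_Y multiplies the volume form exp (-f) dt /\ omega /\ varpi by
    beta(Y) - df(Y) ([nabla_volumeE]).  It is parallel iff beta = df, which is
    equivalent to the equation: evaluate on X^sigma for one direction, and use
    the computation above for the other ([volume_parallelP]).

    Smoothness means the existence and continuity of all iterated directional
    derivatives.  On finite-dimensional spaces this gives differentiability, and
    with it the chain rule, the product rules and the symmetry of second
    derivatives on which the computations rest. *)

(** * Finite-dimensional normed modules *)

(** Encoded by a finite spanning family with continuous linear coordinates,
    indexed by an arbitrary finite type: disjoint sums and products of index
    types then serve for products of spaces and for matrices. *)
Class finite_dim {R : realType} (V : normedModType R) : Prop :=
  finite_dimP : exists (I : finType) (e : I -> V) (l : I -> {linear V -> R}),
    (forall i, continuous (l i)) /\ forall v, v = \sum_i l i v *: e i.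

Section FiniteDim.
Context {R : realType}.

Lemma finite_dim_scalar : @finite_dim R R.
Proof.
exists unit, (fun=> 1), (fun=> idfun); split; first by move=> _ x.
by move=> v; rewrite big_const card_unit /= addr0 [RHS]mulr1.
Qed.

Lemma finite_dim_mx m n : @finite_dim R 'M[R]_(m, n).
Proof.
have lin (ij : 'I_m * 'I_n) : linear (fun N : 'M[R]_(m, n) => N ij.1 ij.2 : R).
  by move=> a u v; rewrite !mxE.
pose l ij : {linear 'M[R]_(m, n) -> R} := HB.pack
  (fun N : 'M[R]_(m, n) => N ij.1 ij.2 : R) (GRing.isLinear.Build _ _ _ _ _ (lin ij)).
exists ('I_m * 'I_n)%type, (fun ij => delta_mx ij.1 ij.2), l; split.
  by move=> [i j]; exact: coord_continuous.
move=> N; rewrite {1}(matrix_sum_delta N) pair_big.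
by apply: eq_bigr => -[i j] _.
Qed.

Lemma finite_dim_prod (V W : normedModType R) :
  finite_dim V -> finite_dim W -> @finite_dim R (V * W)%type.
Proof.
move=> [I [e [l [lc le]]]] [J [f [m [mc me]]]].
exists (I + J)%type, (fun k => match k with inl i => (e i, 0) | inr j => (0, f j) end).
exists (fun k => match k with
  inl i => (l i \o fst : {linear (V * W)%type -> R})
  | inr j => (m j \o snd : {linear (V * W)%type -> R}) end); split.
  move=> [i|j] x; apply: continuous_comp; [exact: cvg_fst|exact: lc|exact: cvg_snd|exact: mc].
move=> [v w]; rewrite big_sumType /=.
rewrite (eq_bigr (fun i => (l i v *: e i, 0))); last first.
  by move=> i _; rewrite -[LHS]/(l i v *: e i, l i v *: (0 : W)) scaler0.
rewrite [X in _ + X](eq_bigr (fun j => (0, m j w *: f j))); last first.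
  by move=> i _; rewrite -[LHS]/(m i w *: (0 : V), m i w *: f i) scaler0.
have fstE (K : finType) (h : K -> V) : \sum_k (h k, 0 : W) = (\sum_k h k, 0).
  apply: (big_ind2 (fun (a : V * W) b => a = (b, 0))) => // _ c _ d -> ->.
  by rewrite -[LHS]/(c + d, (0 : W) + 0) addr0.
have sndE (K : finType) (h : K -> W) : \sum_k (0 : V, h k) = (0, \sum_k h k).
  apply: (big_ind2 (fun (a : V * W) b => a = (0, b))) => // _ c _ d -> ->.
  by rewrite -[LHS]/((0 : V) + 0, c + d) addr0.
by rewrite fstE sndE -[RHS]/(_ + 0, 0 + _) addr0 add0r -le -me.
Qed.

End FiniteDim.

#[export] Existing Instance finite_dim_scalar.
#[export] Existing Instance finite_dim_mx.
#[export] Existing Instance finite_dim_prod.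


(** * Differentiability from continuous directional derivatives *)

Lemma cvg_sumr {R : realType} (W : normedModType R) (T I : Type)
    (F : set_system T) (s : seq I) (f : I -> T -> W) (l : I -> W) :
  Filter F -> (forall i, f i x @[x --> F] --> l i) ->
  \sum_(i <- s) f i x @[x --> F] --> \sum_(i <- s) l i.
Proof.
by move=> FF fl; apply: cvg_big => // -[x y]; exact: add_continuous.
Qed.

Section Differentiability.
Context {R : realType} {V : normedModType R}.
Implicit Types (f : V -> R) (x v : V).

(** Restricted to a line, the difference quotient of f is literally the same
    function of the increment. *)
Lemma derivable_line (W : normedModType R) (f : V -> W) x v (s : R) :
  derivable f (s *: v + x) v ->
  is_derive s 1 (fun r : R => f (r *: v + x)) ('D_v f (s *: v + x)).
Proof.
set g := fun r : R => f (r *: v + x) => df.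
have gE : (fun h : R => h^-1 *: ((g \o shift s) (h *: 1) - g s)) =
    (fun h => h^-1 *: ((f \o shift (s *: v + x)) (h *: v) - f (s *: v + x))).
  by apply/funext => h; rewrite /g /= [h *: 1]mulr1 scalerDl addrA.
by apply: DeriveDef; rewrite /derivable /derive gE.
Qed.

Lemma is_derive_line_scale f x v (a s : R) :
  derivable f ((s * a) *: v + x) v ->
  is_derive s 1 (fun r : R => f ((r * a) *: v + x))
    (a * 'D_v f ((s * a) *: v + x)).
Proof.
move=> /derivable_line dl.
have dm : is_derive s 1 ( *%R^~ a) a.
  have -> : *%R^~ a = ( *:%R^~ a : R -> R) by [].
  apply: DeriveDef; first exact/diff_derivable.
  by rewrite deriveE // diff_val scale1r.
have [h1 h2] := dm; have [h3 h4] := dl.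
move: h1 h3 => /derivable1_diffP h1 /derivable1_diffP h3.
have -> : (fun r => f ((r * a) *: v + x)) =
  (fun r : R => f (r *: v + x)) \o *%R^~ a by [].
apply: DeriveDef; first exact/derivable1_diffP/differentiable_comp.
rewrite -derive1E derive1_comp //; try exact/derivable1_diffP.
by rewrite !derive1E h4 h2 mulrC.
Qed.

Lemma mean_value_line f x v (a : R) :
  (forall s : R, 0 <= s <= 1 -> derivable f ((s * a) *: v + x) v) ->
  exists2 s : R, 0 <= s <= 1 &
    f (a *: v + x) - f x = a * 'D_v f ((s * a) *: v + x).
Proof.
move=> df.
have dg (s : R) s01 := is_derive_line_scale (df s s01).
have [s||s sI] := @MVT_segment R (fun r => f ((r * a) *: v + x))
  (fun r => a * 'D_v f ((r * a) *: v + x)) 0 1 ler01.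
- by rewrite in_itv /= => /andP[s0 s1]; apply: dg; rewrite !ltW.
- apply: derivable_within_continuous => s; rewrite in_itv /= => s01.
  by have [] := dg _ s01.
- rewrite mul1r mul0r scale0r add0r subr0 mulr1 => h.
  by exists s => //; move: sI; rewrite in_itv.
Qed.

Lemma continuous_near_ball (W : normedModType R) (D : set V) (f : V -> W) x (e : R) :
  open D -> D x -> {for x, continuous f} -> 0 < e ->
  exists2 r : R, 0 < r & forall h, `|h| < r -> D (h + x) /\ `|f (h + x) - f x| < e.
Proof.
move=> oD Dx cf e0.
have : \forall y \near x, D y /\ `|f y - f x| < e.
  near=> y; split; near: y; first exact: open_nbhs_nbhs.
  by near=> y; rewrite distrC; near: y; move/cvgrPdist_lt: cf; apply.
move=> /nbhs_ballP[r r0 rD]; exists r => // h hr; apply: rD.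
by rewrite -ball_normE /ball_ /= opprD addrCA subrr addr0 normrN.
Unshelve. all: by end_near. Qed.

(** The increment is reached by moving along one e_i after the other. The
    mean value theorem evaluates each step as a partial derivative at a
    point close to x, and continuity of the partial derivatives replaces
    that point by x. *)
Lemma increment_littleo f (D : set V) x (I : finType) (e : I -> V)
    (l : I -> {linear V -> R}) (s : seq I) :
  open D -> D x ->
  (forall i, continuous (l i)) ->
  (forall i y, D y -> derivable f y (e i)) ->
  (forall i, {for x, continuous ('D_(e i) f)}) ->
  forall eps : R, 0 < eps -> \forall h \near (0 : V),
    `|f (\sum_(i <- s) l i h *: e i + x) - f x
      - \sum_(i <- s) l i h * 'D_(e i) f x| <= eps * `|h|.
Proof.
move=> oD Dx lc df cdf; elim: s => [|i s IH] eps eps0.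
  near=> h; rewrite !big_nil add0r !subrr normr0 mulr_ge0 //; exact: ltW.
have [k k0 lk] := linear_lipschitz (lc i).
have eps2 : 0 < eps / 2 by rewrite divr_gt0.
have epsk : 0 < eps / 2 / k by rewrite divr_gt0.
have [r r0 rD] := continuous_near_ball oD Dx (cdf i) epsk.
(* the displacement along the directions already treated *)
pose y (h : V) := \sum_(j <- s) l j h *: e j.
have near_small : \forall h \near (0 : V), `|y h| + `|l i h| * `|e i| < r.
  have c : {for 0, continuous (fun h => `|y h| + `|l i h| * `|e i|)}.
    apply: cvgD; last first.
      by apply: cvgMr_tmp; apply: cvg_norm; exact: lc.
    apply: cvg_norm; apply: cvg_sumr => j; apply: cvgZr_tmp; exact: lc.
  have /cvgrPdist_lt/(_ _ r0) := c; apply: filterS => h.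
  rewrite /y linear0 normr0 mul0r addr0 big1 => [|j _]; last by rewrite linear0 scale0r.
  rewrite normr0 sub0r normrN; exact: le_lt_trans (ler_norm _).
near=> h; rewrite !big_cons -/(y h).
have small : `|y h| + `|l i h| * `|e i| < r by near: h.
have mv (t : R) : 0 <= t <= 1 -> `|(t * l i h) *: e i + y h| < r.
  move=> /andP[t0 t1]; apply: le_lt_trans small; rewrite addrC.
  apply: (le_trans (ler_normD _ _)); rewrite lerD2l normrZ ler_wpM2r //.
  by rewrite normrM ger0_norm // ler_piMl.
have [t|t t01] := @mean_value_line f (y h + x) (e i) (l i h).
  by move=> /mv /rD[Dt _]; rewrite addrA; exact: df.
set a := f (y h + x); set d := 'D_(e i) f _ => ft; rewrite -[_ + y h + x]addrA.
set b := f (_ + (_ + _)) in ft *; set c := f x; set S := \sum_(j <- s) _.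
have -> : b - c - (l i h * 'D_(e i) f x + S) =
    l i h * (d - 'D_(e i) f x) + (a - c - S).
  by rewrite mulrBr -ft !addrA; ring.
rewrite (le_trans (ler_normD _ _)) // [eps]splitr mulrDl lerD //; last first.
  by rewrite /a /S /c /y; near: h; exact: IH eps2.
have [_ /ltW h1] := rD _ (mv _ t01).
rewrite normrM /d addrA (le_trans (ler_pM _ _ (lk h) h1)) //.
by rewrite mulrAC [k * _]mulrC divfK ?gt_eqF.
Unshelve. all: by end_near. Qed.

(** Continuity of f itself is a consequence, which lets the lemma produce
    the continuity of a primitive whose directional derivatives are known. *)
Lemma C1_differentiable_scalar {fV : finite_dim V} (D : set V) f x :
  open D -> D x -> (forall v y, D y -> derivable f y v) ->
  (forall v, {for x, continuous ('D_v f)}) -> differentiable f x.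
Proof.
move=> oD Dx df cdf; have [I [e [l [lc le]]]] := fV.
have linL : linear (fun h => \sum_i l i h * 'D_(e i) f x : R).
  move=> a u v; rewrite scaler_sumr -big_split /=; apply: eq_bigr => i _.
  by rewrite linearP mulrDl -[_ *: _ * _]mulrA.
pose L : {linear V -> R} := HB.pack (fun h => \sum_i l i h * 'D_(e i) f x : R)
  (GRing.isLinear.Build _ _ _ _ _ linL).
have cL : continuous L.
  move=> y; rewrite /L /=; apply: cvg_sumr => i; apply: cvgMr_tmp; exact: lc.
have fL : f \o shift x = cst (f x) + L +o_ 0 id.
  apply/eqaddoP => eps eps0.
  have := @increment_littleo f D x I e l (index_enum I) oD Dx lc
    (fun i => df (e i)) (fun i => cdf (e i)) _ eps0.
  apply: filterS => h; rewrite -le => H.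
  by rewrite !fctE /= opprD addrA.
apply/diff_locallyP; rewrite (diff_unique cL fL); split => //.
Qed.

End Differentiability.

Section LinearMaps.
Context {R : realType} {V W U : normedModType R}.

Lemma finite_dim_continuous {fV : finite_dim V} (L : {linear V -> W}) :
  continuous L.
Proof.
have [I [e [l [lc le]]]] := fV.
have -> : (L : V -> W) = (fun v => \sum_i l i v *: L (e i)).
  apply/funext => v; rewrite [in LHS](le v) linear_sum.
  by apply: eq_bigr => i _; rewrite linearZ.
by move=> x; apply: cvg_sumr => i; apply: cvgZr_tmp; exact: lc.
Qed.

Lemma is_derive_linear_comp (L : {linear W -> U}) (f : V -> W) x v :
  continuous L -> derivable f x v -> is_derive x v (L \o f) (L ('D_v f x)).
Proof.
move=> cL df.
have H : (fun h => h^-1 *: (((L \o f) \o shift x) (h *: v) - (L \o f) x)) @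
    0^' --> L ('D_v f x).
  rewrite (_ : (fun h => _) = L \o (fun h : R => h^-1 *: ((f \o shift x) (h *: v) - f x))).
    exact: cvg_comp df (cL _).
  apply/funext => h; rewrite /= -linearB.
  by rewrite linearZZ.
by apply: DeriveDef; [apply/cvg_ex; exists (L ('D_v f x))|exact: cvg_lim H].
Qed.

Lemma derivable_linear_comp (L : {linear W -> U}) (f : V -> W) x v :
  continuous L -> derivable f x v -> derivable (fun y => L (f y)) x v.
Proof. by move=> cL df; have [dL _] := is_derive_linear_comp cL df. Qed.

Lemma derive_linear_comp (L : {linear W -> U}) (f : V -> W) x v :
  continuous L -> derivable f x v ->
  'D_v (fun y => L (f y)) x = L ('D_v f x).
Proof. by move=> cL df; have [_ <-] := is_derive_linear_comp cL df. Qed.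

Lemma derive_sum_seq (I : Type) (s : seq I) (f : I -> V -> W) x v :
  (forall i, derivable (f i) x v) ->
  'D_v (fun y => \sum_(i <- s) f i y) x = \sum_(i <- s) 'D_v (f i) x.
Proof.
move=> df.
have sumE t : (fun y => \sum_(i <- t) f i y) = \sum_(i <- t) f i.
  by apply/funext => y; rewrite fct_sumE.
suff [_ <-] : derivable (\sum_(i <- s) f i) x v /\
    'D_v (\sum_(i <- s) f i) x = \sum_(i <- s) 'D_v (f i) x by rewrite sumE.
elim: s => [|i s [d1 d2]].
  by rewrite !big_nil; split; [exact: (derivable_cst (0 : W))|exact: (derive_cst (0 : W))].
by rewrite !big_cons; split; [exact: derivableD|rewrite deriveD // d2].
Qed.

End LinearMaps.

(** * Closure properties of C^k maps and the chain rule *)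

Section ContinuouslyDifferentiable.
Context {R : realType} {V : normedModType R}.
Implicit Types (k : nat) (D : set V).

Section Codomain.
Context {W : normedModType R}.
Implicit Types (f g : V -> W).

Lemma C_onP k D f : C_on k.+1 D f <->
  (forall x, D x -> {for x, continuous f}) /\
  (forall v, (forall x, D x -> derivable f x v) /\ C_on k D ('D_v f)).
Proof. by []. Qed.

Lemma C_on_continuous k D f x : C_on k D f -> D x -> {for x, continuous f}.
Proof. by case: k => [|k] [fc _]; exact: fc. Qed.

Lemma C_on_derivable k D f x v : C_on k.+1 D f -> D x -> derivable f x v.
Proof. by move=> /C_onP[_ /(_ v)[+ _]]; exact. Qed.

Lemma C_on_derive k D f v : C_on k.+1 D f -> C_on k D ('D_v f).
Proof. by move=> /C_onP[_ /(_ v)[_ +]]. Qed.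

Lemma C_onS k D f : C_on k.+1 D f -> C_on k D f.
Proof.
elim: k f => [|k IH] f; first by case.
move=> /C_onP[fc df]; apply/C_onP; split => // v.
by have [? ?] := df v; split => //; exact: IH.
Qed.

Lemma C_onW k D f : C_on k.+1 D f -> C_on 1 D f.
Proof. by elim: k => // k IH /C_onS. Qed.

Lemma C_on_sub k D D' f : D' `<=` D -> C_on k D f -> C_on k D' f.
Proof.
move=> DD; elim: k f => [|k IH] f [fc df].
  by split => // x /DD; exact: fc.
split => [x /DD|v]; first exact: fc.
by have [d1 d2] := df v; split => [x /DD|]; [exact: d1|exact: IH].
Qed.

(** C^k is a pointwise condition on the iterated derivatives of one globally
    defined map. *)
Lemma C_on_setU k D D' f : C_on k D f -> C_on k D' f -> C_on k (D `|` D') f.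
Proof.
elim: k f => [|k IH] f [fc df] [fc' df'].
  by split => // x [/fc|/fc'].
split => [x [/fc|/fc']//|v].
have [d1 d2] := df v; have [d1' d2'] := df' v.
by split => [x [/d1|/d1']//|]; exact: IH.
Qed.

Lemma open_eq_near D f g x : open D -> D x -> (forall y, D y -> f y = g y) ->
  {near x, f =1 g}.
Proof. by move=> oD Dx fg; near=> y; apply: fg; near: y; exact: open_nbhs_nbhs.
Unshelve. all: by end_near. Qed.

Lemma derive_eq_on D f g x v : open D -> D x -> (forall y, D y -> f y = g y) ->
  'D_v f x = 'D_v g x.
Proof. by move=> oD Dx fg; apply: near_eq_derive; exact: open_eq_near fg. Qed.

Lemma C_on_eq k D f g : open D -> (forall x, D x -> f x = g x) ->
  C_on k D f -> C_on k D g.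
Proof.
move=> oD; have cE (f' g' : V -> W) x : D x -> (forall x, D x -> f' x = g' x) ->
    {for x, continuous f'} -> {for x, continuous g'}.
  move=> Dx fg; rewrite /prop_for /continuous_at -fg // => fc.
  apply: cvg_trans fc; apply: near_eq_cvg.
  exact: open_eq_near fg.
elim: k f g => [|k IH] f g fg [fc df].
  by split => // x Dx; apply: (cE f) => //; exact: fc.
split => [x Dx|v]; first by apply: (cE f) => //; exact: fc.
have [d1 d2] := df v; split => [x Dx|].
  by apply: near_eq_derivable (d1 _ Dx); exact: open_eq_near fg.
by apply: IH d2 => x Dx; exact: derive_eq_on fg.
Qed.

Lemma C_on_cst k D (w : W) : C_on k D (fun=> w).
Proof.
elim: k w => [|k IH] w; first by split => // x _; exact: cvg_cst.
split => [x _|v]; first exact: cvg_cst.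
split => [x _|]; first exact: derivable_cst.
by have -> : 'D_v (fun=> w) = (fun=> 0) by apply/funext => x; rewrite derive_cst.
Qed.

Lemma C_onD k D f g : open D ->
  C_on k D f -> C_on k D g -> C_on k D (fun x => f x + g x).
Proof.
move=> oD; elim: k f g => [|k IH] f g [fc df] [gc dg].
  by split => // x Dx; apply: cvgD; [exact: fc|exact: gc].
split => [x Dx|v]; first by apply: cvgD; [exact: fc|exact: gc].
have [f1 f2] := df v; have [g1 g2] := dg v.
split => [x Dx|]; first by apply: derivableD; [exact: f1|exact: g1].
apply: C_on_eq (IH _ _ f2 g2) => // x Dx.
by rewrite deriveD //; [exact: f1|exact: g1].
Qed.

Lemma C_on_sum k D (I : Type) (s : seq I) (f : I -> V -> W) : open D ->
  (forall i, C_on k D (f i)) -> C_on k D (fun x => \sum_(i <- s) f i x).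
Proof.
move=> oD fk; elim: s => [|i s IH].
  rewrite (_ : (fun x => _) = fun=> 0); first exact: C_on_cst.
  by apply/funext => x; rewrite big_nil.
rewrite (_ : (fun x => _) = fun x => f i x + \sum_(i <- s) f i x); last first.
  by apply/funext => x; rewrite big_cons.
exact: C_onD.
Qed.

End Codomain.

Lemma C_on_linear_comp (W U : normedModType R) k D (f : V -> W)
    (L : {linear W -> U}) : open D -> continuous L ->
  C_on k D f -> C_on k D (fun x => L (f x)).
Proof.
move=> oD cL; elim: k f => [|k IH] f [fc df].
  by split => // x Dx; apply: (@continuous_comp _ _ _ f L); [exact: fc|exact: cL].
split => [x Dx|v].
  by apply: (@continuous_comp _ _ _ f L); [exact: fc|exact: cL].
have [d1 d2] := df v; split => [x Dx|].
  by have [] := is_derive_linear_comp cL (d1 _ Dx).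
apply: C_on_eq (IH _ d2) => // x Dx.
by have [_ <-] := is_derive_linear_comp cL (d1 _ Dx).
Qed.

Lemma C_on_linear (W : normedModType R) k D (L : {linear V -> W}) :
  continuous L -> C_on k D L.
Proof.
move=> cL.
have dL v : 'D_v L = fun=> L v.
  apply/funext => x; rewrite deriveE ?diff_lin //.
  exact: linear_differentiable.
case: k => [|k]; first by split => // x _; exact: cL.
split => [x _|v]; first exact: cL.
split => [x _|]; first exact/diff_derivable/linear_differentiable.
by rewrite dL; exact: C_on_cst.
Qed.

Lemma C_onM k D (f g : V -> R) : open D ->
  C_on k D f -> C_on k D g -> C_on k D (fun x => f x * g x).
Proof.
move=> oD; elim: k f g => [|k IH] f g Cf Cg.
  have [fc _] := Cf; have [gc _] := Cg.
  by split => // x Dx; apply: cvgM; [exact: fc|exact: gc].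
have [fc df] := Cf; have [gc dg] := Cg.
split => [x Dx|v]; first by apply: cvgM; [exact: fc|exact: gc].
have [f1 f2] := df v; have [g1 g2] := dg v.
split => [x Dx|]; first by apply: derivableM; [exact: f1|exact: g1].
have := C_onD oD (IH _ _ (C_onS Cf) g2) (IH _ _ (C_onS Cg) f2).
apply: C_on_eq => // x Dx.
by rewrite deriveM //; [exact: f1|exact: g1].
Qed.

Section FiniteDimCodomain.
Context {W : normedModType R} {fW : finite_dim W}.

(** Coordinatewise this is a product of two real-valued functions. *)
Lemma C_onZ k D (f : V -> R) (g : V -> W) : open D ->
  C_on k D f -> C_on k D g -> C_on k D (fun x => f x *: g x).
Proof.
move=> oD Cf Cg; have [J [w [m [mc me]]]] := fW.
have H : C_on k D (fun x => \sum_j (f x * m j (g x)) *: w j).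
  apply: C_on_sum => // j.
  pose S (y : R) : W := y *: w j.
  have Slin : linear S by move=> a u u'; rewrite /S scalerDl scalerA.
  pose L : {linear R -> W} := HB.pack S (GRing.isLinear.Build _ _ _ _ _ Slin).
  apply: (@C_on_linear_comp _ _ _ _ _ L) => //; first exact: finite_dim_continuous.
  by apply: C_onM => //; exact: C_on_linear_comp.
apply: C_on_eq H => // x Dx; rewrite [in RHS](me (g x)) scaler_sumr.
by apply: eq_bigr => j _; rewrite scalerA.
Qed.

Lemma C_on_coords k D (J : finType) (m : J -> {linear W -> R}) (w : J -> W)
    (f : V -> W) : open D ->
  (forall y, y = \sum_j m j y *: w j) ->
  (forall j, C_on k D (fun x => m j (f x))) -> C_on k D f.
Proof.
move=> oD me Cf; have H : C_on k D (fun x => \sum_j m j (f x) *: w j).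
  by apply: C_on_sum => // j; apply: C_onZ => //; exact: C_on_cst.
by apply: C_on_eq H => // x Dx; rewrite -me.
Qed.

Context {fV : finite_dim V}.

(** Coordinatewise reduction to real-valued maps. *)
Lemma C_on_differentiable k D (f : V -> W) x :
  open D -> C_on k.+1 D f -> D x -> differentiable f x.
Proof.
move=> oD /C_onW Cf Dx; have [J [w [m [mc me]]]] := fW.
have dm j : differentiable (fun y => m j (f y) *: w j) x.
  have Cm : C_on 1 D (fun y => m j (f y)) by exact: C_on_linear_comp.
  apply: differentiableZl; apply: (C1_differentiable_scalar oD Dx) => v.
    by move=> y; exact: C_on_derivable Cm.
  exact: C_on_continuous (C_on_derive v Cm) Dx.
have -> : f = \sum_(j <- index_enum J) (fun y => m j (f y) *: w j).
  by apply/funext => y; rewrite fct_sumE -me.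
elim: (index_enum J) => [|j s IH].
  by rewrite big_nil; exact: (differentiable_cst (0 : W)).
by rewrite big_cons; exact: differentiableD.
Qed.

Lemma derive_is_linear D (f : V -> W) x (a : R) u v :
  open D -> C_on 1 D f -> D x ->
  'D_(a *: u + v) f x = a *: 'D_u f x + 'D_v f x.
Proof.
move=> oD Cf Dx; have df : differentiable f x by exact: C_on_differentiable Cf Dx.
by rewrite !deriveE // linearP.
Qed.

Lemma derive_expand D (f : V -> W) x v (I : finType) (e : I -> V) (l : I -> R) :
  open D -> C_on 1 D f -> D x -> v = \sum_i l i *: e i ->
  'D_v f x = \sum_i l i *: 'D_(e i) f x.
Proof.
move=> oD Cf Dx ->; have df : differentiable f x by exact: C_on_differentiable Cf Dx.
rewrite deriveE // linear_sum; apply: eq_bigr => i _.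
by rewrite linearZ -deriveE.
Qed.

End FiniteDimCodomain.

End ContinuouslyDifferentiable.

Section ChainRule.
Context {R : realType} {V V' W : normedModType R}.
Context {fV : finite_dim V} {fV' : finite_dim V'} {fW : finite_dim W}.

(** Directional derivatives do not compose without differentiability, which
    is where finite dimension enters. *)
Lemma derive_comp (D : set V) (D' : set V') (f : V -> V') (g : V' -> W) x v :
  open D -> open D' -> C_on 1 D f -> C_on 1 D' g -> D x -> D' (f x) ->
  'D_v (fun y => g (f y)) x = 'D_('D_v f x) g (f x).
Proof.
move=> oD oD' Cf Cg Dx Dfx.
have df : differentiable f x by exact: C_on_differentiable Cf Dx.
have dg : differentiable g (f x) by exact: C_on_differentiable Cg Dfx.
have dgf : differentiable (g \o f) x by exact: differentiable_comp.
rewrite -[LHS]/('D_v (g \o f) x) deriveE // diff_comp //=.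
by rewrite -deriveE // -deriveE.
Qed.

Lemma C_on_comp k (D : set V) (D' : set V') (f : V -> V') (g : V' -> W) :
  open D -> open D' -> (forall x, D x -> D' (f x)) ->
  C_on k D f -> C_on k D' g -> C_on k D (fun x => g (f x)).
Proof.
move=> oD oD' DD'; elim: k g => [|k IH] g Cf Cg.
  split => // x Dx; apply: (@continuous_comp _ _ _ f g).
    exact: C_on_continuous Cf Dx.
  exact: C_on_continuous Cg (DD' _ Dx).
split => [x Dx|v].
  apply: (@continuous_comp _ _ _ f g).
    exact: C_on_continuous Cf Dx.
  exact: C_on_continuous Cg (DD' _ Dx).
have [I [e [l [lc le]]]] := fV'.
split => [x Dx|].
  apply: diff_derivable; apply: (@differentiable_comp _ _ _ _ f g).
    exact: C_on_differentiable Cf Dx.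
  exact: C_on_differentiable Cg (DD' _ Dx).
have H : C_on k D (fun x => \sum_i l i ('D_v f x) *: 'D_(e i) g (f x)).
  apply: C_on_sum => // i; apply: C_onZ => //.
    by apply: C_on_linear_comp => //; exact: C_on_derive Cf.
  by apply: (IH ('D_(e i) g)); [exact: C_onS|exact: C_on_derive Cg].
apply: C_on_eq H => // x Dx.
rewrite (derive_comp v oD oD' (C_onW Cf) (C_onW Cg) Dx (DD' _ Dx)).
by rewrite -(derive_expand oD' (C_onW Cg) (DD' _ Dx) (le _)).
Qed.

End ChainRule.

Section Projections.
Context {R : realType}.

Definition mx_coord m p (i : 'I_m) (j : 'I_p) (N : 'M[R]_(m, p)) : R := N i j.

Lemma mx_coord_linear m p i j : linear (@mx_coord m p i j).
Proof. by move=> a u v; rewrite /mx_coord !mxE. Qed.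

HB.instance Definition _ m p i j := GRing.isLinear.Build R 'M[R]_(m, p) R _
  (@mx_coord m p i j) (@mx_coord_linear m p i j).

Context {V : normedModType R}.
Implicit Types (D : set V).

Lemma C_on_coord k D m p (f : V -> 'M[R]_(m, p)) i j : open D ->
  C_on k D f -> C_on k D (fun x => f x i j : R).
Proof.
move=> oD Cf; apply: (C_on_linear_comp (L := @mx_coord m p i j)) => //.
exact: coord_continuous.
Qed.

Lemma C_on_mx k D m p (f : V -> 'M[R]_(m, p)) : open D ->
  (forall i j, C_on k D (fun x => f x i j : R)) -> C_on k D f.
Proof.
move=> oD Cf.
apply: (@C_on_coords _ _ _ (finite_dim_mx m p) _ _ ('I_m * 'I_p)%type
  (fun ij => @mx_coord m p ij.1 ij.2) (fun ij => delta_mx ij.1 ij.2)) => //.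
  move=> N; rewrite {1}(matrix_sum_delta N) pair_big.
  by apply: eq_bigr => -[i j] _.
by move=> [i j]; exact: Cf.
Qed.

Context {W U : normedModType R}.

Lemma C_on_fst k D (f : V -> (W * U)%type) : open D ->
  C_on k D f -> C_on k D (fun x => (f x).1).
Proof.
move=> oD Cf; apply: (C_on_linear_comp (L := fst)) => //.
by move=> x; exact: cvg_fst.
Qed.

Lemma C_on_snd k D (f : V -> (W * U)%type) : open D ->
  C_on k D f -> C_on k D (fun x => (f x).2).
Proof.
move=> oD Cf; apply: (C_on_linear_comp (L := snd)) => //.
by move=> x; exact: cvg_snd.
Qed.

Lemma C_on_pair k D (f : V -> W) (g : V -> U) : open D ->
  C_on k D f -> C_on k D g -> C_on k D (fun x => (f x, g x)).
Proof.
move=> oD Cf Cg.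
have lin1 : linear (fun w : W => (w, 0 : U)).
  by move=> a u v; rewrite -[RHS]/(_, a *: 0 + 0) scaler0 addr0.
have lin2 : linear (fun w : U => (0 : W, w)).
  by move=> a u v; rewrite -[RHS]/(a *: 0 + 0, _) scaler0 addr0.
pose L1 : {linear W -> (W * U)%type} := HB.pack (fun w : W => (w, 0 : U))
  (GRing.isLinear.Build _ _ _ _ _ lin1).
pose L2 : {linear U -> (W * U)%type} := HB.pack (fun w : U => (0 : W, w))
  (GRing.isLinear.Build _ _ _ _ _ lin2).
have C1 : C_on k D (fun x => L1 (f x)).
  apply: C_on_linear_comp => // x; apply: cvg_pair; [exact: cvg_id|exact: cvg_cst].
have C2 : C_on k D (fun x => L2 (g x)).
  apply: C_on_linear_comp => // x; apply: cvg_pair; [exact: cvg_cst|exact: cvg_id].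
apply: C_on_eq (C_onD oD C1 C2) => // x Dx.
by rewrite -[LHS]/(f x + 0, 0 + g x) addr0 add0r.
Qed.

Lemma C_on_id k D : C_on k D id.
Proof. by apply: (@C_on_linear _ _ _ k D idfun) => x. Qed.

End Projections.

(** * Symmetry of second derivatives and Lie brackets *)

Section Schwarz.
Context {R : realType} {V : normedModType R}.

Lemma is_derive_translate (W : normedModType R) (f : V -> W) x v w :
  derivable f (w + x) v ->
  is_derive x v (fun y => f (w + y)) ('D_v f (w + x)).
Proof.
set g := fun y => f (w + y) => df.
have gE : (fun h : R => h^-1 *: ((g \o shift x) (h *: v) - g x)) =
    (fun h => h^-1 *: ((f \o shift (w + x)) (h *: v) - f (w + x))).
  by apply/funext => h; rewrite /g /= addrCA.
by apply: DeriveDef; rewrite /derivable /derive gE.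
Qed.

(** Two applications of the mean value theorem: first in direction u to the
    increment of f by s v, then in direction v to the derivative of f along
    u. *)
Lemma second_difference (f : V -> R) (D : set V) x u v (eps : R) :
  open D -> D x -> C_on 2 D f -> 0 < eps ->
  \forall s \near (0 : R),
    `|f (s *: v + (s *: u + x)) - f (s *: u + x) - (f (s *: v + x) - f x)
      - s * (s * 'D_v ('D_u f) x)| <= eps * (s * s).
Proof.
move=> oD Dx Cf eps0.
have Cu := C_on_derive u Cf; have Cvu := C_on_derive v Cu.
have [r r0 rD] := continuous_near_ball oD Dx (C_on_continuous Cvu Dx) eps0.
have near_small : \forall s \near (0 : R), `|s| * (`|u| + `|v|) < r.
  have c : {for 0, continuous (fun s : R => `|s| * (`|u| + `|v|))}.
    apply: cvgMr_tmp; apply: cvg_norm; exact: cvg_id.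
  have /cvgrPdist_lt/(_ _ r0) := c; apply: filterS => s.
  rewrite normr0 mul0r sub0r normrN; exact: le_lt_trans (ler_norm _).
near=> s; have small : `|s| * (`|u| + `|v|) < r by near: s.
have mv (t t' : R) : 0 <= t <= 1 -> 0 <= t' <= 1 ->
    `|(t' * s) *: v + (t * s) *: u| < r.
  move=> /andP[t0 t1] /andP[t0' t1']; apply: le_lt_trans small.
  rewrite mulrDr addrC (le_trans (ler_normD _ _)) // !normrZ.
  rewrite (ger0_norm t0) (ger0_norm t0').
  by apply: lerD; rewrite ler_wpM2r // ler_piMl.
have D0 (t : R) : 0 <= t <= 1 -> D ((t * s) *: u + x).
  move=> t01; have [] := rD _ (mv t 0 t01 _); first by rewrite lexx ler01.
  by rewrite mul0r scale0r add0r.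
have D1 (t t' : R) : 0 <= t <= 1 -> 0 <= t' <= 1 ->
    D ((t' * s) *: v + ((t * s) *: u + x)).
  by move=> t01 t01'; have [] := rD _ (mv t t' t01 t01'); rewrite addrA.
have i1 : 0 <= (1 : R) <= 1 by rewrite lexx ler01.
pose g y := f (s *: v + y) - f y.
have dg t : 0 <= t <= 1 -> is_derive ((t * s) *: u + x) u g
    ('D_u f (s *: v + ((t * s) *: u + x)) - 'D_u f ((t * s) *: u + x)).
  move=> t01; apply: is_deriveB.
    apply: is_derive_translate; apply: C_on_derivable Cf _.
    by have := D1 t 1 t01 i1; rewrite mul1r.
  by apply: derivableP; apply: C_on_derivable Cf _; exact: D0.
have [t|t t01 gE] := @mean_value_line R V g x u s.
  by move=> /dg[].
have [_ dgE] := dg _ t01.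
have [t'|t' t01' uE] := @mean_value_line R V ('D_u f) ((t * s) *: u + x) v s.
  by move=> t01'; apply: C_on_derivable Cu _; exact: D1.
rewrite -/(g (s *: u + x)) -/(g x) gE dgE uE -!mulrBr !normrM.
have [_ /ltW] := rD _ (mv _ _ t01 t01'); rewrite -addrA => h.
rewrite mulrA -normrM -expr2 ger0_norm ?sqr_ge0 // mulrC.
by rewrite ler_wpM2r // sqr_ge0.
Unshelve. all: by end_near. Qed.

(** The second difference is symmetric in u and v, and divided by s^2 it
    approximates both mixed derivatives. *)
Lemma derive_swap_scalar (f : V -> R) (D : set V) x u v :
  open D -> D x -> C_on 2 D f -> 'D_u ('D_v f) x = 'D_v ('D_u f) x.
Proof.
move=> oD Dx Cf; apply/eqP; rewrite -subr_eq0 -normr_le0.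
apply/ler_addgt0Pl => eps eps0; rewrite addr0.
have e2 : 0 < eps / 2 by rewrite divr_gt0.
have H1 := second_difference u v oD Dx Cf e2.
have H2 := second_difference v u oD Dx Cf e2.
have H0 : \forall s \near (0 : R)^', s != 0 by exact: nbhs_dnbhs_neq.
have [s [s0 [h1 h2]]] := filter_ex (filterI H0 (nbhs_dnbhs (filterI H1 H2))).
have ss : 0 < s * s by rewrite -expr2 exprn_even_gt0.
rewrite -(ler_pM2r ss) -{1}(gtr0_norm ss) -normrM.
have -> : ('D_u ('D_v f) x - 'D_v ('D_u f) x) * (s * s) =
  (f (s *: v + (s *: u + x)) - f (s *: u + x) - (f (s *: v + x) - f x)
      - s * (s * 'D_v ('D_u f) x)) -
  (f (s *: u + (s *: v + x)) - f (s *: v + x) - (f (s *: u + x) - f x)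
      - s * (s * 'D_u ('D_v f) x)).
  rewrite [s *: u + (s *: v + x)]addrCA.
  move: (f (_ + (_ + _))) (f (s *: u + x)) (f (s *: v + x)) (f x) => a b c d.
  by move: ('D_u _ x) ('D_v _ x) => p q; ring.
apply: (le_trans (ler_normB _ _)); rewrite [eps in leRHS]splitr mulrDl.
exact: lerD h1 h2.
Qed.

End Schwarz.

Section SecondDerivatives.
Context {R : realType} {V W : normedModType R}.
Context {fV : finite_dim V} {fW : finite_dim W}.
Implicit Types (D : set V) (f : V -> W).

Lemma coord_ext (J : finType) (m : J -> {linear W -> R}) (w : J -> W) a b :
  (forall y, y = \sum_j m j y *: w j) -> (forall j, m j a = m j b) -> a = b.
Proof.
by move=> me ab; rewrite (me a) (me b); apply: eq_bigr => j _; rewrite ab.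
Qed.

Lemma derive_swap D f x u v : open D -> D x -> C_on 2 D f ->
  'D_u ('D_v f) x = 'D_v ('D_u f) x.
Proof.
move=> oD Dx Cf; have [J [w [m [mc me]]]] := fW.
have E u' v' j : m j ('D_u' ('D_v' f) x) = 'D_u' ('D_v' (fun y => m j (f y))) x.
  rewrite -derive_linear_comp //; last exact: C_on_derivable (C_on_derive v' Cf) Dx.
  apply: (derive_eq_on _ oD Dx) => y Dy.
  by rewrite derive_linear_comp //; exact: C_on_derivable Cf Dy.
apply: (coord_ext me) => j; rewrite !E.
exact: derive_swap_scalar oD Dx (C_on_linear_comp oD (mc j) Cf).
Qed.

Lemma derive_scale D (a : V -> R) f x v : open D -> D x ->
  C_on 1 D a -> C_on 1 D f ->
  'D_v (fun y => a y *: f y) x = 'D_v a x *: f x + a x *: 'D_v f x.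
Proof.
move=> oD Dx Ca Cf; have [J [w [m [mc me]]]] := fW.
have da : derivable a x v := C_on_derivable Ca Dx.
have df : derivable f x v := C_on_derivable Cf Dx.
apply: (coord_ext me) => j.
rewrite -derive_linear_comp //; last exact: C_on_derivable (C_onZ oD Ca Cf) Dx.
rewrite (_ : (fun y => _) = a * (fun y => m j (f y))); last first.
  by apply/funext => y; rewrite linearZ.
have dmf : derivable (fun y => m j (f y)) x v by exact: derivable_linear_comp.
rewrite (deriveM da dmf).
rewrite derive_linear_comp // linearD !linearZZ addrC; congr (_ + _).
exact: mulrC.
Qed.

Lemma C_on_derive_along k D (Y : V -> V) f : open D ->
  C_on k D Y -> C_on k.+1 D f -> C_on k D (fun x => 'D_(Y x) f x).
Proof.
move=> oD CY Cf; have [I [e [l [lc le]]]] := fV.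
have H : C_on k D (fun x => \sum_i l i (Y x) *: 'D_(e i) f x).
  apply: C_on_sum => // i; apply: C_onZ => //.
    exact: C_on_linear_comp.
  exact: C_on_derive.
apply: C_on_eq H => // x Dx.
by rewrite -(derive_expand oD (C_onW Cf) Dx (le _)).
Qed.

(** Leibniz rule in the coordinates of Y: one term differentiates the
    coefficients, the other the partial derivatives of f. *)
Lemma derive_derive_along D (Y : V -> V) f x w : open D -> D x ->
  C_on 1 D Y -> C_on 2 D f ->
  'D_w (fun y => 'D_(Y y) f y) x = 'D_('D_w Y x) f x + 'D_w ('D_(Y x) f) x.
Proof.
move=> oD Dx CY Cf; have [I [e [l [lc le]]]] := fV.
have Cf1 := C_onW Cf; have Ce i := C_on_derive (e i) Cf.
have dsum (a : I -> V -> R) : (forall i, C_on 1 D (a i)) ->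
    'D_w (fun y => \sum_i a i y *: 'D_(e i) f y) x =
    \sum_i ('D_w (a i) x *: 'D_(e i) f x + a i x *: 'D_w ('D_(e i) f) x).
  move=> Ca; elim: (index_enum I) => [|i s IH].
    rewrite big_nil (_ : (fun y => _) = fun=> 0) ?derive_cst //.
    by apply/funext => y; rewrite big_nil.
  rewrite big_cons -IH -(derive_scale w oD Dx (Ca i) (Ce i)).
  rewrite -deriveD.
  - by congr ('D_w _ x); apply/funext => y; rewrite big_cons.
  - by apply: C_on_derivable (C_onZ oD (Ca i) (Ce i)) Dx.
  - apply: C_on_derivable (C_on_sum s oD (fun i => C_onZ oD (Ca i) (Ce i))) Dx.
rewrite (derive_eq_on w oD Dx (g := fun y => \sum_i l i (Y y) *: 'D_(e i) f y)); last first.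
  by move=> y Dy; apply: (derive_expand oD Cf1 Dy).
rewrite dsum => [|i]; last exact: C_on_linear_comp.
rewrite big_split /=; congr (_ + _).
  rewrite (derive_expand oD Cf1 Dx (le _)); apply: eq_bigr => i _.
  have dY : derivable Y x w := C_on_derivable CY Dx.
  have E : 'D_w (fun y => l i (Y y)) x = l i ('D_w Y x).
    exact: derive_linear_comp.
  by rewrite E.
rewrite (derive_eq_on w oD Dx (g := fun y => \sum_i l i (Y x) *: 'D_(e i) f y)); last first.
  by move=> y Dy; apply: (derive_expand oD Cf1 Dy).
rewrite dsum => [|i]; last exact: C_on_cst.
by apply: eq_bigr => i _; rewrite derive_cst scale0r add0r.
Qed.

(** The second-order terms cancel by symmetry, only the derivatives of the
    coefficients remain. *)
Lemma derive_bracket D (X Y : V -> V) f x : open D -> D x ->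
  C_on 1 D X -> C_on 1 D Y -> C_on 2 D f ->
  'D_(X x) (fun y => 'D_(Y y) f y) x - 'D_(Y x) (fun y => 'D_(X y) f y) x =
  'D_('D_(X x) Y x - 'D_(Y x) X x) f x.
Proof.
move=> oD Dx CX CY Cf.
rewrite (derive_derive_along (X x) oD Dx CY Cf).
rewrite (derive_derive_along (Y x) oD Dx CX Cf).
rewrite (derive_swap (X x) (Y x) oD Dx Cf) opprD addrACA subrr addr0.
have Cf1 := C_onW Cf.
rewrite [in RHS]addrC -[in RHS]scaleN1r (derive_is_linear _ _ _ oD Cf1 Dx).
by rewrite scaleN1r addrC.
Qed.

End SecondDerivatives.

(** * The Poincare lemma on star-shaped open sets *)

Section CompactBound.
Context {R : realType}.

Lemma compact_bound (T : topologicalType) (g : T -> R) (K : set T) :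
  compact K -> (forall x, K x -> {for x, continuous g}) ->
  exists2 C : R, 0 <= C & forall x, K x -> `|g x| <= C.
Proof.
move=> cK cg; have [K0|/set0P/negP] := pselect (K !=set0); last first.
  by rewrite negbK => /eqP ->; exists 0.
have cn : {within K, continuous (fun x => `|g x|)}.
  apply: continuous_in_subspaceT => x /set_mem Kx.
  by apply: cvg_norm; exact: cg.
have [c Kc cmax] := compact_EVT_max K0 cK cn.
by exists `|g c| => // x Kx; apply: cmax; exact/mem_set.
Qed.

Lemma unit_interval_integral_derive (F f : R -> R) :
  (forall s : R, 0 <= s <= 1 -> is_derive s 1 F (f s)) ->
  (forall s : R, 0 <= s <= 1 -> {for s, continuous f}) ->
  (\int[lebesgue_measure]_(s in `[0%R, 1%R]) f s)%R = F 1 - F 0.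
Proof.
move=> dF cf; have i1 : 0 <= (1 : R) <= 1 by rewrite lexx ler01.
have i0 : 0 <= (0 : R) <= 1 by rewrite lexx ler01.
have Fc s : 0 <= s <= 1 -> {for s, continuous F}.
  move=> /dF[/derivable1_diffP h _]; exact: differentiable_continuous.
have := @continuous_FTC2 R f F 0 1 ltr01.
rewrite /Rintegral => ->.
- by [].
- apply: continuous_in_subspaceT => s /set_mem; rewrite /= in_itv /=.
  exact: cf.
- split => [s|| ].
  + by rewrite in_itv /= => /andP[s0 s1]; have [|//] := dF s; rewrite !ltW.
  + by apply: cvg_at_right_filter; exact: Fc.
  + by apply: cvg_at_left_filter; exact: Fc.
- move=> s; rewrite in_itv /= => /andP[s0 s1].
  by rewrite derive1E; have [|_ //] := dF s; rewrite !ltW.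
Qed.

End CompactBound.

Section PoincareLemma.
Context {R : realType} {V : normedModType R} {fV : finite_dim V}.
Variables (D : set V) (x0 : V) (alpha : V -> V -> R).
Hypothesis oD : open D.
Hypothesis starD : forall x (s : R), D x -> 0 <= s <= 1 -> D (x0 + s *: (x - x0)).
Hypothesis alpha_linear : forall q a u v,
  alpha q (a *: u + v) = a * alpha q u + alpha q v.
Hypothesis alpha_smooth : forall u, smooth_on D (alpha ^~ u).
Hypothesis alpha_closed : forall u v q, D q ->
  'D_v (alpha ^~ u) q = 'D_u (alpha ^~ v) q.

(** The integral of alpha over the segment from x0 to q. *)
Definition radial_integral (q : V) : R :=
  (\int[lebesgue_measure]_(s in `[0%R, 1%R]) alpha (s *: (q - x0) + x0) (q - x0))%R.

(** After differentiation under the integral sign, closedness of alpha turns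
    the integrand into the derivative of s |-> s alpha (x0 + s (q - x0))
    (u), whose integral over [0, 1] is alpha q u. *)
Lemma is_derive_radial_integral q u : D q ->
  is_derive q u radial_integral (alpha q u).
Proof.
move=> Dq; set w := q - x0.
pose G (h s : R) : V := (h * s) *: u + (s *: w + x0).
pose f (h s : R) : R := alpha (G h s) w + h * alpha (G h s) u.
have Fline h : radial_integral (h *: u + q) =
    (\int[lebesgue_measure]_(s in `[0%R, 1%R]) f h s)%R.
  rewrite /radial_integral; congr Rintegral; apply/funext => s.
  rewrite -addrA -/w alpha_linear scalerDr scalerA [s * h]mulrC.
  by rewrite -(addrA _ _ x0) [LHS]addrC.
have [r r0 rD] : exists2 r : R, 0 < r & forall h, `|h| < r -> D (h + q).
  have [r r0 rD] := continuous_near_ball oD Dq (@cst_continuous _ _ (0 : R) q) ltr01.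
  by exists r => // h /rD[].
have u1 : 0 < `|u| + 1 by rewrite ltr_wpDl.
(* the 1 guards against u = 0; halving leaves room for closed intervals *)
pose d := r / (`|u| + 1) / 2.
have d0 : 0 < d by rewrite !divr_gt0.
have Dh (h : R) : `|h| <= d -> D (h *: u + q).
  move=> hd; apply: rD; rewrite normrZ.
  apply: (@le_lt_trans _ _ (d * (`|u| + 1))).
    by apply: ler_pM => //; rewrite lerDl.
  by rewrite /d mulrAC divfK ?gt_eqF // ltr_pdivrMr // ltr_pMr // ltr1n.
have DG (h s : R) : `|h| <= d -> 0 <= s <= 1 -> D (G h s).
  move=> hd s01; have := starD (Dh _ hd) s01.
  by rewrite -addrA -/w scalerDr scalerA [s * h]mulrC addrC -addrA.
(* G h s is the point at parameter s of the segment from x0 to q + h u; K is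
   compact, so the derivatives of alpha are bounded on it *)
pose K := [set G x.1 x.2 | x in `[-d, d] `*` `[0 : R, 1]].
have KD : K `<=` D.
  move=> _ [[h s] /= [+ +] <-]; rewrite /= !in_itv /= -ler_norml.
  exact: DG.
have cG : continuous (fun x : R * R => G x.1 x.2).
  move=> x; rewrite /G; apply: cvgD.
    by apply: cvgZr_tmp; apply: cvgM; [exact: cvg_fst|exact: cvg_snd].
  apply: cvgD; last exact: cvg_cst.
  by apply: cvgZr_tmp; exact: cvg_snd.
have cK : compact K.
  apply: continuous_compact.
    exact: continuous_subspaceT cG.
  by apply: compact_setX; exact: segment_compact.
have KG (h s : R) : `|h| <= d -> 0 <= s <= 1 -> K (G h s).
  by move=> hd s01; exists (h, s) => //=; rewrite !in_itv /= -ler_norml.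
have Cc v x : D x -> {for x, continuous (alpha ^~ v)}.
  by move=> Dx; exact: C_on_continuous (alpha_smooth v 0) Dx.
have Cd v v' x : D x -> {for x, continuous ('D_v' (alpha ^~ v))}.
  by move=> Dx; exact: C_on_continuous (C_on_derive v' (alpha_smooth v 1)) Dx.
have cGs (h s : R) : {for s, continuous (G h)}.
  apply: cvgD; first by apply: cvgZr_tmp; apply: cvgMl_tmp; exact: cvg_id.
  by apply: cvgD; [apply: cvgZr_tmp; exact: cvg_id|exact: cvg_cst].
have Ca (h s : R) v : `|h| <= d -> 0 <= s <= 1 ->
    {for s, continuous (fun s : R => alpha (G h s) v)}.
  move=> hd s01; apply: (@continuous_comp _ _ _ (G h) (alpha ^~ v)) => //.
  exact: Cc (DG _ _ hd s01).
(* the derivative of f in h *)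
pose f' (h s : R) := s * 'D_u (alpha ^~ w) (G h s) +
  (alpha (G h s) u + h * (s * 'D_u (alpha ^~ u) (G h s))).
have df (h s : R) : `|h| <= d -> 0 <= s <= 1 -> is_derive h 1 (f ^~ s) (f' h s).
  move=> hd s01; have Dg := DG _ _ hd s01.
  have d1 v : is_derive h 1 (fun r => alpha (G r s) v) (s * 'D_u (alpha ^~ v) (G h s)).
    apply: is_derive_line_scale; exact: C_on_derivable (alpha_smooth v 1) Dg.
  have fE : f ^~ s = (fun r => alpha (G r s) w) +
      (id : R -> R) * (fun r => alpha (G r s) u) by [].
  rewrite fE; apply: (is_derive_eq (is_deriveD (d1 w)
    (is_deriveM (is_derive_id h (1 : R)) (d1 u)))).
  rewrite /f'; congr (_ + _); rewrite addrC; congr (_ + _).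
  exact: mulr1.
have [C1 C10 H1] := compact_bound cK (fun x Kx => Cd w u x (KD x Kx)).
have [C2 C20 H2] := compact_bound cK (fun x Kx => Cd u u x (KD x Kx)).
have [C3 C30 H3] := compact_bound cK (fun x Kx => Cc u x (KD x Kx)).
have mI : measurable (`[0, 1] : set (measurableTypeR R)) by exact: measurable_itv.
have I0 : `](- d), d[%classic (0 : R) by rewrite /= in_itv /= oppr_lt0 d0.
have Id h : `](- d), d[%classic h -> `|h| <= d.
  by rewrite /= in_itv /= ler_norml => /andP[? ?]; rewrite !ltW.
have intf h : `](- d), d[%classic h ->
    lebesgue_measure.-integrable (`[0, 1] : set (measurableTypeR R)) (EFin \o f h).
  move=> /Id hd; apply: continuous_compact_integrable.
    exact: segment_compact.
  apply: continuous_in_subspaceT => s /set_mem; rewrite /= in_itv /= => s01.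
  apply: cvgD; first exact: Ca.
  by apply: cvgMl_tmp; exact: Ca.
have derf h s : `](- d), d[%classic h -> `[0, 1]%classic s -> derivable (f ^~ s) h 1.
  by move=> /Id hd; rewrite /= in_itv /= => s01; have [] := df _ _ hd s01.
(* a bound for the three terms of f', uniform in h and s *)
pose C := C1 + (C3 + d * C2).
have C0 : 0 <= C by rewrite !addr_ge0 // mulr_ge0 // ltW.
have intG : lebesgue_measure.-integrable (`[0, 1] : set (measurableTypeR R))
    (EFin \o (fun=> C)).
  apply: continuous_compact_integrable; first exact: segment_compact.
  by apply: continuous_subspaceT => s; exact: cvg_cst.
have Gub h s : `](- d), d[%classic h -> `[0, 1]%classic s ->
    `|partial1of2 f h s| <= C.
  move=> /Id hd; rewrite /= in_itv /= => s01; rewrite partial1of2E.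
  have [_ ->] := df _ _ hd s01; have Kg := KG _ _ hd s01.
  move/andP: s01 => [s0 s1].
  apply: (le_trans (ler_normD _ _)); apply: lerD.
    by rewrite normrM ger0_norm // -[leRHS]mul1r ler_pM // H1.
  apply: (le_trans (ler_normD _ _)); apply: lerD; first exact: H3.
  rewrite !normrM ler_pM ?mulr_ge0 // -[leRHS]mul1r (ger0_norm s0).
  by rewrite ler_pM // H2.
have dF := derivable_under_integral mI I0 intf derf (fun=> C0) intG Gub.
have eF := differentiation_under_integral mI I0 intf derf (fun=> C0) intG Gub.
have lineE : (fun h : R => radial_integral (h *: u + q)) =
    (fun h => (\int[lebesgue_measure]_(s in `[0%R, 1%R]) f h s)%R).
  by apply/funext => h; exact: Fline.
have d00 : `|0 : R| <= d by rewrite normr0 ltW.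
have G0 s : G 0 s = s *: w + x0 by rewrite /G mul0r scale0r add0r.
have val : (\int[lebesgue_measure]_(s in `[0%R, 1%R]) partial1of2 f 0 s)%R = alpha q u.
  have -> : alpha q u = 1 * alpha (1 *: w + x0) u - 0 * alpha (0 *: w + x0) u.
    by rewrite mul1r mul0r subr0 scale1r subrK.
  transitivity (\int[lebesgue_measure]_(s in `[0%R, 1%R]) f' 0 s)%R.
    apply: eq_Rintegral => s /set_mem; rewrite /= in_itv /= => s01; rewrite partial1of2E.
    by have [_ ->] := df _ _ d00 s01.
  apply: (@unit_interval_integral_derive R (fun s => s * alpha (s *: w + x0) u)) => s s01.
    have Dg := DG _ _ d00 s01; rewrite /f' G0 in Dg *.
    have dl : is_derive s 1 (fun r : R => alpha (r *: w + x0) u)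
        ('D_w (alpha ^~ u) (s *: w + x0)).
      apply: (derivable_line (f := alpha ^~ u)).
      exact: C_on_derivable (alpha_smooth u 1) Dg.
    have fE : (fun s => s * alpha (s *: w + x0) u) =
      (id : R -> R) * (fun r => alpha (r *: w + x0) u) by [].
    rewrite fE; apply: (is_derive_eq (is_deriveM (is_derive_id s (1 : R)) dl)).
    rewrite mul0r addr0 alpha_closed //; congr (_ + _).
    exact: mulr1.
  apply: cvgD.
    apply: cvgM; first exact: cvg_id.
    apply: (@continuous_comp _ _ _ (G 0) ('D_u (alpha ^~ w))); first exact: cGs.
    exact: Cd (DG _ _ d00 s01).
  apply: cvgD; first exact: Ca.
  apply: cvgMl_tmp; apply: cvgM; first exact: cvg_id.
  apply: (@continuous_comp _ _ _ (G 0) ('D_u (alpha ^~ u))); first exact: cGs.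
  exact: Cd (DG _ _ d00 s01).
have dq : derivable radial_integral q u by apply/derivable1P; rewrite lineE.
apply: DeriveDef => //.
have [_ <-] : is_derive (0 : R) (1 : R)
    (fun h : R => radial_integral (h *: u + q)) ('D_u radial_integral q).
  have H : derivable radial_integral ((0 : R) *: u + q) u by rewrite scale0r add0r.
  by have := derivable_line H; rewrite scale0r add0r.
by rewrite lineE -derive1E eF.
Qed.

Lemma radial_integral_smooth : smooth_on D radial_integral.
Proof.
have dE v q : D q -> 'D_v radial_integral q = alpha q v.
  by move=> /is_derive_radial_integral h; have [_ ->] := h v.
have cont q : D q -> {for q, continuous radial_integral}.
  move=> Dq; apply: differentiable_continuous.
  apply: (C1_differentiable_scalar oD Dq) => v.
    by move=> y /is_derive_radial_integral h; have [] := h v.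
  have := C_on_continuous (C_on_eq oD (fun x Dx => esym (dE v x Dx)) (alpha_smooth v 0)).
  exact.
case=> [|k]; first by split.
split => // v; split => [y /is_derive_radial_integral h|]; first by have [] := h v.
by apply: C_on_eq (alpha_smooth v k) => // x Dx; rewrite dE.
Qed.

End PoincareLemma.

Lemma poincare {R : realType} {V : normedModType R} {fV : finite_dim V}
    (D : set V) (alpha : V -> V -> R) :
  open D -> star_shaped D ->
  (forall q a u v, alpha q (a *: u + v) = a * alpha q u + alpha q v) ->
  (forall u, smooth_on D (alpha ^~ u)) ->
  (forall u v q, D q -> 'D_v (alpha ^~ u) q = 'D_u (alpha ^~ v) q) ->
  exists2 f : V -> R, smooth_on D f & forall q u, D q -> 'D_u f q = alpha q u.
Proof.
move=> oD [x0 _ starD] lin sm cl; exists (radial_integral x0 alpha).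
  exact: radial_integral_smooth.
by move=> q u Dq; have [_ ->] := is_derive_radial_integral oD starD lin sm cl u Dq.
Qed.

(** * A smooth bump function *)

Section BumpFunction.
Context {R : realType}.

(** For p = 1 this is the classical flat function exp (-1/x); the polynomial
    factor in 1/x makes the family stable under differentiation. *)
Definition flat (p : {poly R}) (x : R) : R :=
  if 0 < x then p.[x^-1] * expR (- x^-1) else 0.

(** y^i <= i! exp y for each monomial. *)
Lemma poly_expR_bounded (p : {poly R}) :
  exists2 C : R, 0 <= C & forall y, 0 <= y -> `|p.[y]| * expR (- y) <= C.
Proof.
exists (\sum_(i < size p) `|p`_i| * i`!%:R) => [|y y0].
  by apply: sumr_ge0 => i _; rewrite mulr_ge0.
rewrite expRN ler_pdivrMr ?expR_gt0 // horner_coef.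
apply: (le_trans (ler_norm_sum _ _ _)); rewrite mulr_suml; apply: ler_sum => i _.
rewrite normrM normrX (ger0_norm y0) -mulrA ler_wpM2l //.
case: (nat_of_ord i) => [|m]; first by rewrite expr0 fact0 mul1r -expR0 ler_expR.
have := expR_ge1Dxn m y0; move/(le_trans _) => /(_ (y ^+ m.+1 / m.+1`!%:R)).
rewrite lerDr ler01 => /(_ isT).
by rewrite ler_pdivrMr ?ltr0n ?fact_gt0 // mulrC.
Qed.

(** Boundedness of y^2 p(y) exp (-y) at y = 1/x. A quadratic bound is what
    makes the derivative at 0 vanish. *)
Lemma flat_quadratic p : exists2 C : R, 0 <= C &
  forall x, `|flat p x| <= C * x ^+ 2.
Proof.
have [C C0 HC] := poly_expR_bounded ('X^2 * p); exists C => // x.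
rewrite /flat; case: ifP => [x0|_]; last by rewrite normr0 mulr_ge0 // sqr_ge0.
have := HC x^-1; rewrite invr_ge0 ltW // => /(_ isT).
rewrite hornerM hornerXn normrM normrX normfV (gtr0_norm x0) exprVn.
rewrite normrM (gtr0_norm (expR_gt0 _)) -mulrA mulrC.
by rewrite ler_pdivrMr // exprn_gt0.
Qed.

(** Away from 0, d/dx [p(1/x) exp (-1/x)] = x^-2 (p - p')(1/x) exp (-1/x). *)
Lemma is_derive_flat (p : {poly R}) (x : R) :
  is_derive x (1 : R) (flat p) (flat ('X^2 * (p - p^`())) x).
Proof.
have [x0|x0|->] := ltgtP x 0.
- rewrite {2}/flat ltNge (ltW x0) /=.
  apply: (near_eq_is_derive _ (is_derive_cst (0 : R) x (1 : R))).
  near=> y; rewrite /flat ltNge ifN // negbK ltW //; near: y; exact: lt_nbhsl.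
- have xn0 : x != 0 by rewrite gt_eqF.
  have dV : is_derive x (1 : R) (fun y : R => y^-1) (- x ^- 2).
    apply: is_derive_eq (is_deriveV (f := id) xn0 (is_derive_id x (1 : R))) _.
    exact: mulr1.
  have dp := is_derive1_comp (is_derive_poly p x^-1) dV.
  have de := is_derive1_comp (f := expR) (g := fun y => - y^-1)
    (is_derive_expR _) (is_deriveN dV).
  apply: near_eq_is_derive (is_derive_eq (is_deriveM dp de) _).
    near=> y; rewrite /flat ifT //; near: y; exact: lt_nbhsr.
  rewrite /flat x0 hornerM hornerXn hornerD hornerN exprVn /=.
  rewrite -![_ *: _]/(_ * _).
  by ring.
- rewrite {2}/flat ltxx; have [C C0 HC] := flat_quadratic p.
  have H : (fun h : R => h^-1 *: ((flat p \o shift 0) (h *: 1) - flat p 0)) @ 0^' --> 0.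
    apply/cvgrPdist_le => e e0; near=> h.
    rewrite sub0r normrN {2}/flat ltxx subr0 /= addr0 [h *: 1]mulr1.
    have h0 : h != 0 by near: h; exact: nbhs_dnbhs_neq.
    rewrite normrM normfV ler_pdivrMl ?normr_gt0 //.
    have hC : `|h| < e / (C + 1).
      by near: h; apply: dnbhs0_lt; rewrite divr_gt0 // ltr_wpDl.
    apply: (le_trans (HC h)); rewrite -[h ^+ 2]real_normK ?num_real // expr2.
    rewrite mulrCA ler_wpM2l //.
    rewrite ltr_pdivlMr ?ltr_wpDl // in hC; apply: le_trans (ltW hC).
    by rewrite mulrC ler_wpM2l // lerDl.
  by apply: DeriveDef; [apply/cvg_ex; exists 0|exact: cvg_lim H].
Unshelve. all: by end_near. Qed.

Lemma flat_smooth p : smooth_on setT (flat p).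
Proof.
have dE (v : R) q : 'D_v (flat q) = fun x => v * flat ('X^2 * (q - q^`())) x.
  apply/funext => x; have [d1 d2] := is_derive_flat q x.
  move/derivable1_diffP: d1 => d1; rewrite deriveE // -[v in LHS]mulr1.
  by rewrite -[v * 1]/(v *: 1) linearZ /= -deriveE // d2.
have dd (v : R) q x : derivable (flat q) x v.
  have [d1 _] := is_derive_flat q x.
  by apply: diff_derivable; exact/derivable1_diffP.
have cc q x : {for x, continuous (flat q)}.
  have [/derivable1_diffP d1 _] := is_derive_flat q x.
  exact: differentiable_continuous.
move=> k; elim: k p => [|k IH] p; first by split.
split => // v; split => //; rewrite dE.
by apply: C_onM; [exact: openT|exact: C_on_cst|exact: IH].
Qed.

Variable n : nat.
Implicit Types (x y : 'rV[R]_n) (r : R).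

Definition bump y r x : R := flat 1 (r ^+ 2 - \sum_i (x 0 i - y 0 i) ^+ 2).

Lemma bump_center y r : 0 < r -> bump y r y != 0.
Proof.
move=> r0; rewrite /bump big1 => [|i _]; last by rewrite subrr expr0n.
rewrite subr0 /flat exprn_gt0 // hornerC mul1r gt_eqF //.
exact: expR_gt0.
Qed.

Lemma bump_support y r x : 0 < r -> bump y r x != 0 -> `|x - y| <= r.
Proof.
move=> r0; rewrite /bump /flat; case: ifP => [|_]; last by rewrite eqxx.
rewrite subr_gt0 => sr _; rewrite [`|_|]mx_normrE.
apply: bigmax_le => [|[i j] _]; first exact: ltW.
rewrite !mxE /= [i]ord1 -(@ler_pXn2r _ 2) ?nnegrE ?(ltW r0) //.
rewrite real_normK ?num_real //; apply: le_trans (ltW sr).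
by rewrite (bigD1 j) //= lerDl sumr_ge0 // => k _; exact: sqr_ge0.
Qed.

Lemma bump_smooth y r : smooth_on setT (bump y r).
Proof.
move=> k; apply: (C_on_comp (D' := setT) (g := flat 1)) => //; try exact: openT.
  apply: C_onD; [exact: openT|exact: C_on_cst|].
  rewrite (_ : (fun x => _) = fun x => (- 1) * \sum_i (x 0 i - y 0 i) ^+ 2); last first.
    by apply/funext => x; rewrite mulN1r.
  apply: C_onM; [exact: openT|exact: C_on_cst|].
  apply: C_on_sum => [|i]; first exact: openT.
  rewrite (_ : (fun x => _) = fun x => (x 0 i - y 0 i) * (x 0 i - y 0 i)); last first.
    by apply/funext => x; rewrite expr2.
  have Ci : C_on k setT (fun x => x 0 i - y 0 i).
    apply: C_onD; [exact: openT| |exact: C_on_cst].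
    by apply: C_on_coord; [exact: openT|exact: C_on_id].
  by apply: C_onM => //; exact: openT.
exact: flat_smooth.
Qed.

End BumpFunction.

(** * Derivatives of products and determinants of matrices *)

Section Determinant.

(** Expanding each determinant along its replaced column leaves the
    cofactors of A. *)
Lemma sum_det_replace_col (K : comNzRingType) N (A B : 'M[K]_N) :
  \sum_b \det (\matrix_(i, j) if j == b then B i j else A i j) =
  \tr (\adj A *m B).
Proof.
apply: eq_bigr => b _; rewrite (expand_det_col _ b) mxE; apply: eq_bigr => i _.
rewrite !mxE eqxx mulrC; congr (_ * _); rewrite /cofactor; congr (_ * \det _).
by apply/matrixP => k l; rewrite !mxE eq_sym (negbTE (neq_lift _ _)).
Qed.

Context {R : realType} {V : normedModType R}.
Implicit Types (D : set V) (x v : V).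

Lemma C_on_prod k D (I : Type) (s : seq I) (h : I -> V -> R) : open D ->
  (forall i, C_on k D (h i)) -> C_on k D (fun x => \prod_(i <- s) h i x).
Proof.
move=> oD Ch; elim: s => [|i s IH].
  rewrite (_ : (fun x => _) = fun=> 1); first exact: C_on_cst.
  by apply/funext => x; rewrite big_nil.
rewrite (_ : (fun x => _) = fun x => h i x * \prod_(i <- s) h i x); last first.
  by apply/funext => x; rewrite big_cons.
exact: C_onM.
Qed.

Lemma derive_prod D (I : eqType) (s : seq I) (h : I -> V -> R) x v :
  open D -> D x -> (forall i, C_on 1 D (h i)) -> uniq s ->
  'D_v (fun y => \prod_(i <- s) h i y) x =
  \sum_(k <- s) \prod_(i <- s) (if i == k then 'D_v (h i) x else h i x).
Proof.
move=> oD Dx Ch; elim: s => [_|a s IH /= /andP[als us]].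
  rewrite big_nil (_ : (fun y => _) = fun=> 1) ?derive_cst //.
  by apply/funext => y; rewrite big_nil.
rewrite (_ : (fun y => _) = (h a) * (fun y => \prod_(i <- s) h i y)); last first.
  by apply/funext => y; rewrite big_cons.
rewrite deriveM; first last.
- exact: C_on_derivable (C_on_prod s oD Ch) Dx.
- exact: C_on_derivable (Ch a) Dx.
rewrite IH // big_cons addrC; congr (_ + _).
  rewrite big_cons eqxx [RHS]mulrC; congr (_ * _).
  rewrite !big_seq; apply: eq_bigr => i si; case: eqP => // ia.
  by rewrite -ia si in als.
rewrite -[_ *: _]/(_ * _) mulr_sumr !big_seq; apply: eq_bigr => k sk.
rewrite big_cons; case: eqP => // ak.
by rewrite ak sk in als.
Qed.

Lemma derive_entry m p (A : V -> 'M[R]_(m, p)) x v i j : derivable A x v ->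
  'D_v A x i j = 'D_v (fun y => A y i j : R) x.
Proof. by move=> dA; rewrite derive_mx // mxE. Qed.

Lemma C_on_det k D N (A : V -> 'M[R]_N) : open D ->
  C_on k D A -> C_on k D (fun x => \det (A x)).
Proof.
move=> oD CA; apply: C_on_sum => // s; apply: C_onM => //; first exact: C_on_cst.
by apply: C_on_prod => // i; exact: C_on_coord.
Qed.

(** Jacobi's formula: the Leibniz rule replaces one column at a time. *)
Lemma derive_det D N (A : V -> 'M[R]_N) x v : open D -> D x -> C_on 1 D A ->
  'D_v (fun y => \det (A y)) x = \tr (\adj (A x) *m 'D_v A x).
Proof.
move=> oD Dx CA; have dA : derivable A x v := C_on_derivable CA Dx.
have Ce i j : C_on 1 D (fun y => A y i j : R) by exact: C_on_coord.
rewrite -sum_det_replace_col.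
rewrite (_ : (fun y => _) =
  (fun y => \sum_(s : 'S_N) (-1) ^+ s * \prod_i A y (s i) i)); last first.
  apply/funext => y; rewrite -det_tr; apply: eq_bigr => s _.
  by congr (_ * _); apply: eq_bigr => i _; rewrite mxE.
have Cp (s : 'S_N) : C_on 1 D (fun y => \prod_i A y (s i) i : R).
  exact: C_on_prod.
rewrite derive_sum_seq => [|s]; last first.
  by apply: C_on_derivable Dx; apply: C_onM => //; exact: C_on_cst.
transitivity (\sum_(s : 'S_N) \sum_k (-1) ^+ s *
    \prod_i (if i == k then 'D_v A x (s i) i else A x (s i) i)).
  apply: eq_bigr => s _; rewrite [LHS](deriveMl ((-1) ^+ s) (C_on_derivable (Cp s) Dx)).
  rewrite (derive_prod (h := fun i y => A y (s i) i) _ oD Dx) ?index_enum_uniq //.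
  rewrite mulr_sumr; apply: eq_bigr => k _; congr (_ * _); apply: eq_bigr => i _.
  by rewrite derive_entry.
rewrite exchange_big; apply: eq_bigr => k _.
rewrite -[in RHS]det_tr; apply: eq_bigr => s _; congr (_ * _).
by apply: eq_bigr => i _; rewrite !mxE.
Qed.

Lemma C_on_mulmx k D m p q (A : V -> 'M[R]_(m, p)) (B : V -> 'M[R]_(p, q)) :
  open D -> C_on k D A -> C_on k D B -> C_on k D (fun x => A x *m B x).
Proof.
move=> oD CA CB; apply: C_on_mx => // i j.
rewrite (_ : (fun x => _) = fun x => \sum_l A x i l * B x l j); last first.
  by apply/funext => x; rewrite mxE.
by apply: C_on_sum => // l; apply: C_onM => //; exact: C_on_coord.
Qed.

Lemma derive_mulmx D m p q (A : V -> 'M[R]_(m, p)) (B : V -> 'M[R]_(p, q)) x v :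
  open D -> D x -> C_on 1 D A -> C_on 1 D B ->
  'D_v (fun y => A y *m B y) x = 'D_v A x *m B x + A x *m 'D_v B x.
Proof.
move=> oD Dx CA CB; apply/matrixP => i j.
have dA : derivable A x v := C_on_derivable CA Dx.
have dB : derivable B x v := C_on_derivable CB Dx.
have dAB : derivable (fun y => A y *m B y) x v.
  exact: C_on_derivable (C_on_mulmx oD CA CB) Dx.
rewrite derive_entry // !mxE -big_split /=.
rewrite (_ : (fun y => _) = fun y => \sum_l A y i l * B y l j); last first.
  by apply/funext => y; rewrite mxE.
have CAe l : C_on 1 D (fun y => A y i l : R) by exact: C_on_coord.
have CBe l : C_on 1 D (fun y => B y l j : R) by exact: C_on_coord.
rewrite derive_sum_seq => [|l]; last exact: C_on_derivable (C_onM oD (CAe l) (CBe l)) Dx.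
apply: eq_bigr => l _; rewrite !derive_entry //.
rewrite deriveM; first last.
- exact: C_on_derivable (CBe l) Dx.
- exact: C_on_derivable (CAe l) Dx.
by rewrite addrC; congr (_ + _); exact: mulrC.
Qed.

End Determinant.

(** * The connection form in the adapted frame *)

Section ConnectionMatrix.
Context {R : realType} {n : nat}.
Local Notation E0 := (R * 'rV[R]_n)%type.
Local Notation E1 := (R * 'rV[R]_n * 'rV[R]_n)%type.
Local Notation ev i := (delta_mx 0 i : 'rV[R]_n).
Local Notation N := (1 + (n + n))%N.
Variable F : E1 -> 'rV[R]_n.
Implicit Types (p q y u v : E1) (X Y Z : E1 -> E1).

Definition i_time : 'I_N := lshift (n + n) ord0.
Definition i_hor (i : 'I_n) : 'I_N := rshift 1 (lshift n i).
Definition i_ver (i : 'I_n) : 'I_N := rshift 1 (rshift n i).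

Lemma index_ind (P : 'I_N -> Prop) : P i_time -> (forall i, P (i_hor i)) ->
  (forall i, P (i_ver i)) -> forall a, P a.
Proof.
move=> Pt Ph Pv a; rewrite -(splitK a); case: (fintype.split a) => [i|b] /=.
  by rewrite [i]ord1; exact: Pt.
by rewrite -(splitK b); case: (fintype.split b) => i /=; [exact: Ph|exact: Pv].
Qed.

Lemma big_index (W : nmodType) (f : 'I_N -> W) :
  \sum_a f a = f i_time + (\sum_i f (i_hor i) + \sum_i f (i_ver i)).
Proof. by rewrite big_split_ord big_ord1 big_split_ord. Qed.

Lemma frame_time p : frame F i_time p = X_sigma F p.
Proof. by rewrite /frame (unsplitK (inl ord0)). Qed.

Lemma frame_hor i p : frame F (i_hor i) p = X_hor F i p.
Proof. by rewrite /frame (unsplitK (inr (lshift n i))) (unsplitK (inl i)). Qed.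

Lemma frame_ver i p : frame F (i_ver i) p = X_ver i p.
Proof. by rewrite /frame (unsplitK (inr (rshift n i))) (unsplitK (inr i)). Qed.

Lemma coframe_time p u : coframe F i_time p u = u.1.1.
Proof. by rewrite /coframe (unsplitK (inl ord0)). Qed.

Lemma coframe_hor i p u : coframe F (i_hor i) p u = omega i p u.
Proof. by rewrite /coframe (unsplitK (inr (lshift n i))) (unsplitK (inl i)). Qed.

Lemma coframe_ver i p u : coframe F (i_ver i) p u = varpi F i p u.
Proof. by rewrite /coframe (unsplitK (inr (rshift n i))) (unsplitK (inr i)). Qed.

Lemma omega_linear i p (c : R) u v :
  omega i p (c *: u + v) = c * omega i p u + omega i p v.
Proof.
rewrite /omega -[(c *: u + v).1.1]/(c * u.1.1 + v.1.1).
by rewrite -[(c *: u + v).1.2]/(c *: u.1.2 + v.1.2) !mxE; ring.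
Qed.

Lemma varpi_linear i p (c : R) u v :
  varpi F i p (c *: u + v) = c * varpi F i p u + varpi F i p v.
Proof.
rewrite /varpi -[(c *: u + v).1.1]/(c * u.1.1 + v.1.1).
rewrite -[(c *: u + v).2]/(c *: u.2 + v.2) !mxE.
rewrite (eq_bigr (fun j => c * (d_xdot j (F_comp F i) p * omega j p u) +
  d_xdot j (F_comp F i) p * omega j p v)); last first.
  by move=> j _; rewrite omega_linear; ring.
by rewrite big_split -mulr_sumr /=; ring.
Qed.

Lemma coframe_linear a p : linear (coframe F a p : E1 -> R).
Proof.
move=> c u v; elim/index_ind: a => [|i|i].
- by rewrite !coframe_time.
- by rewrite !coframe_hor omega_linear.
- by rewrite !coframe_ver varpi_linear.
Qed.

HB.instance Definition _ a p :=
  GRing.isLinear.Build R E1 R _ (coframe F a p) (coframe_linear a p).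

Lemma sum_mul_delta (c : 'I_n -> R) j : \sum_i c i * (i == j)%:R = c j.
Proof.
rewrite (bigD1 j) //= eqxx mulr1 big1 ?addr0 // => i ij.
by rewrite (negbTE ij) mulr0.
Qed.

Lemma sum_scale_delta (c : 'I_n -> R) i : (\sum_k c k *: ev k) 0 i = c i.
Proof.
rewrite summxE (bigD1 i) //= !mxE !eqxx mulr1 big1 ?addr0 // => k ki.
by rewrite !mxE eqxx eq_sym (negbTE ki) mulr0.
Qed.

Lemma omega_X_hor i j p : omega i p (X_hor F j p) = (i == j)%:R.
Proof. by rewrite /omega /= mulr0 subr0 mxE eqxx. Qed.

(** Bundled for rewriting: comparisons between the three kinds of indices of
    the frame. *)
Lemma eq_index : (forall i j, (i_hor i == i_hor j) = (i == j)) *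
  (forall i j, (i_ver i == i_ver j) = (i == j)) *
  (forall i j, (i_hor i == i_ver j) = false) *
  (forall i j, (i_ver i == i_hor j) = false) *
  (forall i, (i_time == i_hor i) = false) * (forall i, (i_time == i_ver i) = false) *
  (forall i, (i_hor i == i_time) = false) * (forall i, (i_ver i == i_time) = false).
Proof.
by do !split => *; rewrite /i_hor /i_ver /i_time ?eq_shift.
Qed.

Lemma coframe_frame a b p : coframe F a p (frame F b p) = (a == b)%:R.
Proof.
elim/index_ind: b => [|j|j]; rewrite ?(frame_time, frame_hor, frame_ver);
  elim/index_ind: a => [|i|i];
  rewrite ?(coframe_time, coframe_hor, coframe_ver, eqxx, eq_index) //=.
- by rewrite /omega /= mulr1 subrr.
- rewrite /varpi /= mulr1 subrr big1 ?mulr0 ?subr0 // => k _.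
  by rewrite /omega /= mulr1 subrr mulr0.
- exact: omega_X_hor.
- rewrite /varpi /= mulr0 subr0 mxE sum_scale_delta (bigD1 j) //=.
  rewrite omega_X_hor eqxx mulr1 big1 ?addr0 ?subrr // => k kj.
  by rewrite omega_X_hor (negbTE kj) mulr0.
- by rewrite /omega /= mulr0 mxE subr0.
- rewrite /varpi /= mulr0 subr0 mxE eqxx /= big1 ?mulr0 ?subr0 //.
  by move=> k _; rewrite /omega /= mxE mulr0 subr0 mulr0.
Qed.

Lemma frame_expand p u : u = \sum_a coframe F a p u *: frame F a p.
Proof.
rewrite big_index coframe_time frame_time.
rewrite (eq_bigr (fun i => omega i p u *: X_hor F i p)); last first.
  by move=> i _; rewrite coframe_hor frame_hor.
rewrite [X in _ + (_ + X)](eq_bigr (fun i => varpi F i p u *: X_ver i p)); last first.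
  by move=> i _; rewrite coframe_ver frame_ver.
have e11 (s : 'I_n -> E1) : (\sum_i s i).1.1 = \sum_i (s i).1.1.
  exact: (big_morph (fun e : E1 => e.1.1) (fun _ _ => erefl) erefl).
have e12 (s : 'I_n -> E1) : (\sum_i s i).1.2 = \sum_i (s i).1.2.
  exact: (big_morph (fun e : E1 => e.1.2) (fun _ _ => erefl) erefl).
have e2 (s : 'I_n -> E1) : (\sum_i s i).2 = \sum_i (s i).2.
  exact: (big_morph (fun e : E1 => e.2) (fun _ _ => erefl) erefl).
have ext v w : v.1.1 = w.1.1 -> v.1.2 = w.1.2 -> v.2 = w.2 -> v = w.
  by case: v w => [[? ?] ?] [[? ?] ?] /= -> -> ->.
apply: ext.
- rewrite -[RHS]/(u.1.1 * 1 + ((\sum_i _).1.1 + (\sum_i _).1.1)) !e11 mulr1.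
  by rewrite !big1 ?addr0 // => i _; exact: mulr0.
- rewrite -[RHS]/(u.1.1 *: p.2 + ((\sum_i _).1.2 + (\sum_i _).1.2)) !e12.
  rewrite [X in _ + (_ + X)]big1 => [|i _]; last exact: scaler0.
  rewrite addr0 -[X in _ = _ + X]/(\sum_i omega i p u *: ev i).
  apply/rowP => j; rewrite [RHS]mxE sum_scale_delta /omega !mxE.
  by rewrite mulrC addrC subrK.
- rewrite -[RHS]/(u.1.1 *: F p + ((\sum_i _).2 + (\sum_i _).2)) !e2.
  rewrite -[X in _ = _ + (_ + X)]/(\sum_i varpi F i p u *: ev i).
  apply/rowP => j; rewrite [RHS]mxE [X in _ + X]mxE sum_scale_delta summxE mxE.
  rewrite (eq_bigr (fun i => 2^-1 * (d_xdot i (F_comp F j) p * omega i p u))).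
    by rewrite -mulr_sumr /varpi /F_comp; ring.
  move=> i _; rewrite -[LHS]/((omega i p u *: (2^-1 *:
    \sum_k d_xdot i (F_comp F k) p *: ev k)) 0 j).
  by rewrite !mxE sum_scale_delta; ring.
Qed.

(** The block A of the connection form diag (0, A, A) evaluated on y:
    nabla_y X_i = sum_k A_ki X_k, and the same for d/dxdot^i. The
    coefficient of A on d/dxdot^j is zero. *)
Definition conn_mx p y : 'M[R]_n := \matrix_(k, i)
  - (2^-1 * (d_xdot i (F_comp F k) p * y.1.1 +
             \sum_j omega j p y * d_xdot i (d_xdot j (F_comp F k)) p)).

Lemma conn_mx_linear p : linear (conn_mx p).
Proof.
move=> c u v; apply/matrixP => k i; rewrite !mxE.
rewrite -[(c *: u + v).1.1]/(c * u.1.1 + v.1.1).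
rewrite (eq_bigr (fun j => c * (omega j p u * d_xdot i (d_xdot j (F_comp F k)) p) +
  omega j p v * d_xdot i (d_xdot j (F_comp F k)) p)); last first.
  by move=> j _; rewrite omega_linear; ring.
by rewrite big_split -mulr_sumr /=; ring.
Qed.

HB.instance Definition _ p :=
  GRing.isLinear.Build R E1 'M[R]_n _ (conn_mx p) (conn_mx_linear p).

(** The coefficients do not depend on which of the two blocks e stands for. *)
Lemma sum_nabla_block (e : 'I_n -> E1 -> E1) i p y :
  \sum_b coframe F b p y *: nabla_block F e b i p =
  \sum_k conn_mx p y k i *: e k p.
Proof.
rewrite big_index [X in _ + (_ + X)]big1 => [|j _]; last first.
  by rewrite /nabla_block (unsplitK (inr (rshift n j))) (unsplitK (inr j)) scaler0.
rewrite addr0 coframe_time {1}/nabla_block (unsplitK (inl ord0)).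
rewrite [X in _ + X](eq_bigr (fun j => \sum_k - (omega j p y *:
    (2^-1 *: (d_xdot i (d_xdot j (F_comp F k)) p *: e k p))))); last first.
  move=> j _; rewrite coframe_hor /nabla_block.
  rewrite (unsplitK (inr (lshift n j))) (unsplitK (inl j)).
  by rewrite scalerN !scaler_sumr -sumrN.
rewrite exchange_big /= scalerN scalerA scaler_sumr -sumrN -big_split /=.
apply: eq_bigr => k _; rewrite mxE !scalerA -scaleNr.
rewrite (eq_bigr (fun j =>
    - (2^-1 * (omega j p y * d_xdot i (d_xdot j (F_comp F k)) p)) *: e k p)).
  rewrite -scaler_suml -scalerDl; congr (_ *: _).
  by rewrite sumrN -mulr_sumr; ring.
by move=> j _; rewrite !scalerA -scaleNr; congr (_ *: _); ring.
Qed.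

Lemma gl_embed_linear : linear (@gl_embed R n).
Proof.
move=> c A B; rewrite /gl_embed scale_block_mx add_block_mx scale_block_mx.
by rewrite add_block_mx !scaler0 !addr0.
Qed.

HB.instance Definition _ := GRing.isLinear.Build R 'M[R]_n 'M[R]_N _
  (@gl_embed R n) gl_embed_linear.

Lemma gl_embedD (A B : 'M[R]_n) : gl_embed (A + B) = gl_embed A + gl_embed B.
Proof. exact: raddfD. Qed.

Lemma gl_embedB (A B : 'M[R]_n) : gl_embed (A - B) = gl_embed A - gl_embed B.
Proof. exact: raddfB. Qed.

Lemma gl_embedM (A B : 'M[R]_n) : gl_embed (A *m B) = gl_embed A *m gl_embed B.
Proof.
by rewrite /gl_embed !mulmx_block !(mul0mx, mulmx0, addr0, add0r).
Qed.

Lemma mxtrace_gl_embed (A : 'M[R]_n) : \tr (gl_embed A) = \tr A + \tr A.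
Proof. by rewrite /gl_embed !mxtrace_block mxtrace0 add0r. Qed.

Lemma gl_embedE (A : 'M[R]_n) :
  (forall a, gl_embed A a i_time = 0) * (forall a, gl_embed A i_time a = 0) *
  (forall i j, gl_embed A (i_hor i) (i_hor j) = A i j) *
  (forall i j, gl_embed A (i_ver i) (i_ver j) = A i j) *
  (forall i j, gl_embed A (i_hor i) (i_ver j) = 0) *
  (forall i j, gl_embed A (i_ver i) (i_hor j) = 0).
Proof.
rewrite /gl_embed; do !split; first 1 last.
- elim/index_ind => [|j|j]; rewrite /i_time /i_hor /i_ver.
  + by rewrite block_mxEul mxE.
  + by rewrite block_mxEur mxE.
  + by rewrite block_mxEur mxE.
- by move=> i j; rewrite /i_hor block_mxEdr block_mxEul.
- by move=> i j; rewrite /i_ver block_mxEdr block_mxEdr.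
- by move=> i j; rewrite /i_hor /i_ver block_mxEdr block_mxEur mxE.
- by move=> i j; rewrite /i_hor /i_ver block_mxEdr block_mxEdl mxE.
- elim/index_ind => [|j|j]; rewrite /i_time /i_hor /i_ver.
  + by rewrite block_mxEul mxE.
  + by rewrite block_mxEdl mxE.
  + by rewrite block_mxEdl mxE.
Qed.

Lemma coframe_nabla_frame a b p y :
  coframe F a p (\sum_c coframe F c p y *: nabla_frame F c b p) =
  gl_embed (conn_mx p y) a b.
Proof.
elim/index_ind: b => [|i|i].
- rewrite big1 => [|c _]; last by rewrite /nabla_frame (unsplitK (inl ord0)) scaler0.
  by rewrite linear0 gl_embedE.
- rewrite (eq_bigr (fun c => coframe F c p y *: nabla_block F (X_hor F) c i p)); last first.
    move=> c _; rewrite /nabla_frame.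
    by rewrite (unsplitK (inr (lshift n i))) (unsplitK (inl i)).
  rewrite sum_nabla_block linear_sum.
  rewrite (eq_bigr (fun k => conn_mx p y k i * (a == i_hor k)%:R)); last first.
    by move=> k _; rewrite linearZZ /= -frame_hor coframe_frame.
  elim/index_ind: a => [|j|j]; rewrite gl_embedE.
  + by rewrite big1 // => k _; rewrite eq_index mulr0.
  + rewrite (bigD1 j) //= eqxx mulr1 big1 ?addr0 // => k kj.
    by rewrite eq_index eq_sym (negbTE kj) mulr0.
  + by rewrite big1 // => k _; rewrite eq_index mulr0.
- rewrite (eq_bigr (fun c => coframe F c p y *: nabla_block F (@X_ver R n) c i p)); last first.
    move=> c _; rewrite /nabla_frame.
    by rewrite (unsplitK (inr (rshift n i))) (unsplitK (inr i)).
  rewrite sum_nabla_block linear_sum.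
  rewrite (eq_bigr (fun k => conn_mx p y k i * (a == i_ver k)%:R)); last first.
    by move=> k _; rewrite linearZZ /= -frame_ver coframe_frame.
  elim/index_ind: a => [|j|j]; rewrite gl_embedE.
  + by rewrite big1 // => k _; rewrite eq_index mulr0.
  + by rewrite big1 // => k _; rewrite eq_index mulr0.
  + rewrite (bigD1 j) //= eqxx mulr1 big1 ?addr0 // => k kj.
    by rewrite eq_index eq_sym (negbTE kj) mulr0.
Qed.

(** Passing to components in the adapted frame turns nabla_Y into D_Y plus
    multiplication by diag (0, A(Y), A(Y)). *)
Definition comps Z p : 'cV[R]_N := \col_a coframe F a p (Z p).

Lemma comps_nabla Y Z p : derivable (comps Z) p (Y p) ->
  comps (nabla F Y Z) p =
  'D_(Y p) (comps Z) p + gl_embed (conn_mx p (Y p)) *m comps Z p.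
Proof.
move=> dZ; apply/colP => a; rewrite !mxE /nabla linear_sum /=.
rewrite (eq_bigr (fun b => 'D_(Y p) (fun q => coframe F b q (Z q)) p * (a == b)%:R +
   gl_embed (conn_mx p (Y p)) a b * coframe F b p (Z p))); last first.
  move=> b _; rewrite linearD !linearZ /= coframe_frame coframe_nabla_frame.
  by congr (_ + _); exact: mulrC.
rewrite big_split /=; congr (_ + _).
  rewrite (bigD1 a) //= eqxx mulr1 big1 ?addr0.
    by rewrite derive_entry //; congr ('D__ _ _); apply/funext => q; rewrite mxE.
  by move=> b ba; rewrite eq_sym (negbTE ba) mulr0.
by apply: eq_bigr => b _; congr (_ * _); rewrite mxE.
Qed.

End ConnectionMatrix.

(** * Curvature, covariant derivatives and their traces *)

Section Curvature.
Context {R : realType} {n : nat}.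
Local Notation E0 := (R * 'rV[R]_n)%type.
Local Notation E1 := (R * 'rV[R]_n * 'rV[R]_n)%type.
Local Notation ev i := (delta_mx 0 i : 'rV[R]_n).
Local Notation N := (1 + (n + n))%N.
Variables (F : E1 -> 'rV[R]_n) (D : set E1).
Hypotheses (oD : open D) (sF : smooth_on D F).
Implicit Types (p q y u v : E1) (X Y Z : E1 -> E1).

Lemma smooth_F_comp i : smooth_on D (F_comp F i).
Proof. by move=> k; apply: C_on_coord => //; exact: sF. Qed.

Lemma smooth_d_xdot i (f : E1 -> R) : smooth_on D f -> smooth_on D (d_xdot i f).
Proof. by move=> sf k; exact: C_on_derive (sf k.+1). Qed.

Lemma smooth_omega i X : smooth_on D X -> smooth_on D (fun q => omega i q (X q)).
Proof.
move=> sX k; rewrite /omega.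
have C11 : C_on k D (fun q => (X q).1.1) by do 2!apply: C_on_fst => //; exact: sX.
have C12 : C_on k D (fun q => (X q).1.2 0 i : R).
  by apply: C_on_coord => //; apply: C_on_snd => //; apply: C_on_fst => //; exact: sX.
have C2 : C_on k D (fun q => - 1 * (q.2 0 i : R)).
  apply: C_onM => //; first exact: C_on_cst.
  by apply: C_on_coord => //; apply: C_on_snd => //; exact: C_on_id.
apply: C_on_eq (C_onD oD C12 (C_onM oD C2 C11)) => // q Dq.
by rewrite mulN1r mulNr.
Qed.

Lemma smooth_varpi i X : smooth_on D X -> smooth_on D (fun q => varpi F i q (X q)).
Proof.
move=> sX k; rewrite /varpi.
have C11 : C_on k D (fun q => (X q).1.1) by do 2!apply: C_on_fst => //; exact: sX.
have C2 : C_on k D (fun q => (X q).2 0 i : R).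
  by apply: C_on_coord => //; apply: C_on_snd => //; exact: sX.
have CF : C_on k D (fun q => - 1 * F_comp F i q).
  by apply: C_onM => //; [exact: C_on_cst|exact: smooth_F_comp].
have CS : C_on k D (fun q => - 2^-1 * \sum_j d_xdot j (F_comp F i) q * omega j q (X q)).
  apply: C_onM => //; first exact: C_on_cst.
  apply: C_on_sum => // j; apply: C_onM => //; last exact: smooth_omega.
  exact: smooth_d_xdot (smooth_F_comp i) k.
apply: C_on_eq (C_onD oD (C_onD oD C2 (C_onM oD CF C11)) CS) => // q Dq.
by rewrite mulN1r !mulNr.
Qed.

Lemma smooth_coframe a X : smooth_on D X -> smooth_on D (fun q => coframe F a q (X q)).
Proof.
move=> sX k; elim/(@index_ind n): a => [|i|i].
- rewrite (_ : (fun q => _) = fun q => (X q).1.1); last first.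
    by apply/funext => q; rewrite coframe_time.
  by do 2!apply: C_on_fst => //; exact: sX.
- rewrite (_ : (fun q => _) = fun q => omega i q (X q)); last first.
    by apply/funext => q; rewrite coframe_hor.
  exact: smooth_omega.
- rewrite (_ : (fun q => _) = fun q => varpi F i q (X q)); last first.
    by apply/funext => q; rewrite coframe_ver.
  exact: smooth_varpi.
Qed.

Lemma smooth_comps X : smooth_on D X -> smooth_on D (comps F X).
Proof.
move=> sX k; apply: C_on_mx => // a b.
rewrite (_ : (fun q => _) = fun q => coframe F a q (X q)); last first.
  by apply/funext => q; rewrite mxE.
exact: smooth_coframe.
Qed.

Lemma smooth_frame a : smooth_on D (frame F a).
Proof.
move=> k; elim/(@index_ind n): a => [|i|i].
- rewrite (_ : frame F _ = X_sigma F); last by apply/funext => q; rewrite frame_time.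
  apply: C_on_pair => //.
  apply: C_on_pair => //; first exact: C_on_cst.
  by apply: C_on_snd => //; exact: C_on_id.
- rewrite (_ : frame F _ = X_hor F i); last by apply/funext => q; rewrite frame_hor.
  apply: C_on_pair => //; first exact: C_on_cst.
  apply: C_onZ => //; first exact: C_on_cst.
  apply: C_on_sum => // j; apply: C_onZ => //; last exact: C_on_cst.
  exact: smooth_d_xdot (smooth_F_comp j) k.
- rewrite (_ : frame F _ = @X_ver R n i); last by apply/funext => q; rewrite frame_ver.
  exact: C_on_cst.
Qed.

Lemma smooth_of_comps X : smooth_on D (comps F X) -> smooth_on D X.
Proof.
move=> sc k.
have H : C_on k D (fun q => \sum_a comps F X q a 0 *: frame F a q).
  apply: C_on_sum => // a; apply: C_onZ => //; last exact: smooth_frame.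
  by apply: C_on_coord => //; exact: sc.
apply: C_on_eq H => // q Dq; rewrite [RHS](frame_expand F q).
by apply: eq_bigr => a _; rewrite mxE.
Qed.

Lemma smooth_conn_mx X : smooth_on D X -> smooth_on D (fun q => conn_mx F q (X q)).
Proof.
move=> sX k; apply: C_on_mx => // l i.
have H : C_on k D (fun q => - 2^-1 * (d_xdot i (F_comp F l) q * (X q).1.1 +
    \sum_j omega j q (X q) * d_xdot i (d_xdot j (F_comp F l)) q)).
  apply: C_onM => //; first exact: C_on_cst.
  apply: C_onD => //.
    apply: C_onM => //; first exact: smooth_d_xdot (smooth_F_comp l) k.
    by do 2!apply: C_on_fst => //; exact: sX.
  apply: C_on_sum => // j; apply: C_onM => //; first exact: smooth_omega.
  by apply: smooth_d_xdot; apply: smooth_d_xdot; exact: smooth_F_comp.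
by apply: C_on_eq H => // q Dq; rewrite mxE mulNr.
Qed.

Lemma smooth_gl_embed (B : E1 -> 'M[R]_n) : smooth_on D B ->
  smooth_on D (fun q => gl_embed (B q)).
Proof.
move=> sB k; apply: (C_on_linear_comp (L := @gl_embed R n)) => //.
exact: finite_dim_continuous.
Qed.

Lemma derive_gl_embed (B : E1 -> 'M[R]_n) p v : D p -> smooth_on D B ->
  'D_v (fun q => gl_embed (B q)) p = gl_embed ('D_v B p).
Proof.
move=> Dp sB; apply: (derive_linear_comp (L := @gl_embed R n)).
  exact: finite_dim_continuous.
exact: C_on_derivable (sB 1) Dp.
Qed.

Lemma comps_nabla_on Y Z p : smooth_on D Z -> D p ->
  comps F (nabla F Y Z) p =
  'D_(Y p) (comps F Z) p + gl_embed (conn_mx F p (Y p)) *m comps F Z p.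
Proof.
move=> sZ Dp; apply: comps_nabla.
exact: C_on_derivable (smooth_comps sZ 1) Dp.
Qed.

Lemma smooth_nabla Y Z : smooth_on D Y -> smooth_on D Z ->
  smooth_on D (nabla F Y Z).
Proof.
move=> sY sZ; apply: smooth_of_comps => k.
apply: (C_on_eq (f := fun q => 'D_(Y q) (comps F Z) q +
  gl_embed (conn_mx F q (Y q)) *m comps F Z q)) => //.
  by move=> q Dq; exact/esym/comps_nabla_on.
apply: C_onD => //.
  exact: C_on_derive_along oD (sY k) (smooth_comps sZ k.+1).
apply: C_on_mulmx => //; last exact: smooth_comps.
by apply: smooth_gl_embed; exact: smooth_conn_mx.
Qed.

Lemma smooth_lie_bracket X Y : smooth_on D X -> smooth_on D Y ->
  smooth_on D (lie_bracket X Y).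
Proof.
move=> sX sY k; rewrite /lie_bracket.
have C1 : C_on k D (fun q => 'D_(X q) Y q).
  exact: C_on_derive_along oD (sX k) (sY k.+1).
have C2 : C_on k D (fun q => 'D_(Y q) X q).
  exact: C_on_derive_along oD (sY k) (sX k.+1).
have C3 : C_on k D (fun q => - 1 *: 'D_(Y q) X q).
  exact: (C_onZ oD (C_on_cst k D (- 1 : R)) C2).
by apply: C_on_eq (C_onD oD C1 C3) => // q Dq; rewrite scaleN1r.
Qed.

(** The tensorial description of T by the field diag (0, B, B). Restricting
    it to fields smooth on D makes it stable under nabla_end. *)
Definition acts_as (T : (E1 -> E1) -> E1 -> E1) (B : E1 -> 'M[R]_n) : Prop :=
  forall Z, smooth_on D Z -> forall p, D p ->
    comps F (T Z) p = gl_embed (B p) *m comps F Z p.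

Lemma comps_sub X Y Z p : Z p = X p - Y p -> comps F Z p = comps F X p - comps F Y p.
Proof.
move=> ZE; apply/colP => a.
have cE W : comps F W p a 0 = coframe F a p (W p) by rewrite mxE.
rewrite cE ZE (raddfB (coframe F a p)) /= -!cE.
by rewrite [RHS]mxE [X in _ = _ + X]mxE.
Qed.

Lemma comps_curvature X Y Z p : comps F (curvature F X Y Z) p =
  comps F (nabla F X (nabla F Y Z)) p - comps F (nabla F Y (nabla F X Z)) p
  - comps F (nabla F (lie_bracket X Y) Z) p.
Proof.
rewrite -(@comps_sub _ _ (fun q => nabla F X (nabla F Y Z) q - nabla F Y (nabla F X Z) q)) //.
by rewrite -(@comps_sub _ _ (curvature F X Y Z)).
Qed.

Lemma derive_nabla X Y Z p : smooth_on D X -> smooth_on D Y -> smooth_on D Z ->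
  D p ->
  comps F (nabla F X (nabla F Y Z)) p =
  'D_(X p) (fun q => 'D_(Y q) (comps F Z) q) p +
  (gl_embed ('D_(X p) (fun q => conn_mx F q (Y q)) p) *m comps F Z p +
   gl_embed (conn_mx F p (Y p)) *m 'D_(X p) (comps F Z) p) +
  (gl_embed (conn_mx F p (X p)) *m 'D_(Y p) (comps F Z) p +
   gl_embed (conn_mx F p (X p)) *m (gl_embed (conn_mx F p (Y p)) *m comps F Z p)).
Proof.
move=> sX sY sZ Dp; have sz := smooth_comps sZ.
have sG := smooth_gl_embed (smooth_conn_mx sY).
rewrite (comps_nabla_on _ (smooth_nabla sY sZ) Dp) (comps_nabla_on _ sZ Dp) mulmxDr.
congr (_ + _).
rewrite (derive_eq_on _ oD Dp (g := fun q => 'D_(Y q) (comps F Z) q +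
  gl_embed (conn_mx F q (Y q)) *m comps F Z q)); last first.
  by move=> q Dq; exact: comps_nabla_on.
rewrite deriveD; first last.
- exact: C_on_derivable (C_on_mulmx oD (sG 1) (sz 1)) Dp.
- exact: C_on_derivable (C_on_derive_along oD (sY 1) (sz 2)) Dp.
rewrite (derive_mulmx _ oD Dp (sG 1) (sz 1)) derive_gl_embed //.
exact: smooth_conn_mx.
Qed.

(** dA (X, Y) + [A(X), A(Y)]. *)
Definition curvature_form X Y p : 'M[R]_n :=
  'D_(X p) (fun q => conn_mx F q (Y q)) p - 'D_(Y p) (fun q => conn_mx F q (X q)) p
  - conn_mx F p (lie_bracket X Y p)
  + conn_mx F p (X p) *m conn_mx F p (Y p) - conn_mx F p (Y p) *m conn_mx F p (X p).

(** The terms in which a component of Z is differentiated cancel: those of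
    first order in pairs, those of second order against the derivative along
    [X, Y]. *)
Lemma curvature_acts_as X Y : smooth_on D X -> smooth_on D Y ->
  acts_as (curvature F X Y) (curvature_form X Y).
Proof.
move=> sX sY Z sZ p Dp; have sz := smooth_comps sZ.
rewrite comps_curvature (derive_nabla sX sY sZ Dp) (derive_nabla sY sX sZ Dp).
rewrite (comps_nabla_on (lie_bracket X Y) sZ Dp).
have <- : 'D_(X p) (fun q => 'D_(Y q) (comps F Z) q) p -
    'D_(Y p) (fun q => 'D_(X q) (comps F Z) q) p =
    'D_(lie_bracket X Y p) (comps F Z) p.
  exact: derive_bracket oD Dp (sX 1) (sY 1) (sz 2).
rewrite /curvature_form !(gl_embedB, gl_embedD, gl_embedM) !(mulmxBl, mulmxDl) !mulmxA.
have alg (m k : nat) (b1 b2 c1 c2 d1 d2 f1 f2 g : 'M[R]_(m, k)) :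
    b1 + (c1 + d1) + (d2 + f1) - (b2 + (c2 + d2) + (d1 + f2)) - ((b1 - b2) + g) =
    c1 - c2 - g + f1 - f2.
  by apply/matrixP => i j; rewrite !mxE; ring.
exact: alg.
Qed.

Lemma smooth_curvature_form X Y : smooth_on D X -> smooth_on D Y ->
  smooth_on D (curvature_form X Y).
Proof.
move=> sX sY k; rewrite /curvature_form.
have sN (B : E1 -> 'M[R]_n) : C_on k D B -> C_on k D (fun q => - B q).
  move=> CB; have C1 : C_on k D (fun q => - 1 *: B q).
    by apply: C_onZ => //; exact: C_on_cst.
  by apply: C_on_eq C1 => // q Dq; rewrite scaleN1r.
have sA := smooth_conn_mx sX; have sB := smooth_conn_mx sY.
apply: C_onD => //; last by apply: sN; exact: C_on_mulmx.
apply: C_onD => //; last exact: C_on_mulmx.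
apply: C_onD => //; last first.
  by apply: sN; apply: smooth_conn_mx; exact: smooth_lie_bracket.
apply: C_onD => //; last apply: sN.
  exact: C_on_derive_along oD (sX k) (sB k.+1).
exact: C_on_derive_along oD (sY k) (sA k.+1).
Qed.

Lemma smooth_acts_as T B Z : acts_as T B -> smooth_on D B -> smooth_on D Z ->
  smooth_on D (T Z).
Proof.
move=> TB sB sZ; apply: smooth_of_comps => k.
apply: (C_on_eq (f := fun q => gl_embed (B q) *m comps F Z q)) => //.
  by move=> q Dq; exact/esym/TB.
by apply: C_on_mulmx => //; [exact: smooth_gl_embed|exact: smooth_comps].
Qed.

(** The covariant derivative Y(B) + [A(Y), B]. *)
Definition nabla_mx Y (B : E1 -> 'M[R]_n) p : 'M[R]_n :=
  'D_(Y p) B p + conn_mx F p (Y p) *m B p - B p *m conn_mx F p (Y p).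

Lemma nabla_end_acts_as Y T B : smooth_on D Y -> smooth_on D B ->
  acts_as T B -> acts_as (nabla_end F Y T) (nabla_mx Y B).
Proof.
move=> sY sB TB Z sZ p Dp; have sz := smooth_comps sZ.
have sG := smooth_gl_embed sB.
rewrite (@comps_sub (nabla F Y (T Z)) (T (nabla F Y Z))) //.
rewrite (TB _ (smooth_nabla sY sZ) _ Dp).
rewrite (comps_nabla_on _ (smooth_acts_as TB sB sZ) Dp) (comps_nabla_on _ sZ Dp).
rewrite (derive_eq_on _ oD Dp (g := fun q => gl_embed (B q) *m comps F Z q)); last first.
  by move=> q Dq; exact: TB.
rewrite (derive_mulmx _ oD Dp (sG 1) (sz 1)) derive_gl_embed // (TB _ sZ _ Dp).
rewrite /nabla_mx !(gl_embedB, gl_embedD, gl_embedM) !(mulmxBl, mulmxDl, mulmxDr) !mulmxA.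
have alg (m k : nat) (a b c d : 'M[R]_(m, k)) : a + b + c - (b + d) = a + c - d.
  by apply/matrixP => i j; rewrite !mxE; ring.
exact: alg.
Qed.

Lemma smooth_nabla_mx Y B : smooth_on D Y -> smooth_on D B -> smooth_on D (nabla_mx Y B).
Proof.
move=> sY sB k; rewrite /nabla_mx; have sA := smooth_conn_mx sY.
have C1 : C_on k D (fun q => - 1 *: (B q *m conn_mx F q (Y q))).
  by apply: C_onZ => //; [exact: C_on_cst|exact: C_on_mulmx].
have C2 : C_on k D (fun q => 'D_(Y q) B q).
  exact: C_on_derive_along oD (sY k) (sB k.+1).
have C3 := C_on_mulmx oD (sA k) (sB k).
by apply: C_on_eq (C_onD oD (C_onD oD C2 C3) C1) => // q Dq; rewrite scaleN1r.
Qed.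

Lemma derive_mxtrace (B : E1 -> 'M[R]_n) p v : D p -> smooth_on D B ->
  'D_v (fun q => \tr (B q)) p = \tr ('D_v B p).
Proof.
move=> Dp sB; apply: (derive_linear_comp (L := @mxtrace R n)).
  exact: finite_dim_continuous.
exact: C_on_derivable (sB 1) Dp.
Qed.

Lemma mxtrace_nabla_mx Y B p : D p -> smooth_on D B ->
  (forall q, D q -> \tr (B q) = 0) -> \tr (nabla_mx Y B p) = 0.
Proof.
move=> Dp sB B0; rewrite /nabla_mx linearB linearD /= [X in _ - X]mxtrace_mulC addrK.
rewrite -derive_mxtrace // (derive_eq_on _ oD Dp (g := fun=> 0)) //.
exact: derive_cst.
Qed.

Definition traceless_on T := exists B : E1 -> 'M[R]_n,
  [/\ smooth_on D B, acts_as T B & forall q, D q -> \tr (B q) = 0].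

(** Induction on the number of covariant derivatives; commutators are
    traceless and the derivative of the zero function is zero. *)
Lemma nabla_curvature_traceless Vs X Y :
  (forall k, (k < size Vs)%N -> smooth_on D (nth (fun=> 0) Vs k)) ->
  traceless_on (curvature F X Y) -> traceless_on (nabla_curvature F Vs X Y).
Proof.
rewrite /nabla_curvature; move: (curvature F X Y) => T.
elim: Vs T => [|Y' Vs IH] T //= sVs [B [sB TB B0]].
apply: IH => [k kV|]; first exact: (sVs k.+1).
have sY : smooth_on D Y' by exact: (sVs 0%N).
exists (nabla_mx Y' B); split.
- exact: smooth_nabla_mx.
- exact: nabla_end_acts_as.
- by move=> q Dq; exact: mxtrace_nabla_mx.
Qed.

(** The matrix of T in the adapted frame is read off by applying T to the
    frame fields, which are smooth. *)
Lemma end_mx_acts_as T B p : D p -> acts_as T B -> end_mx F T p = gl_embed (B p).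
Proof.
move=> Dp TB; apply/matrixP => a b; rewrite mxE.
have cE c : comps F (frame F b) p c 0 = (c == b)%:R by rewrite mxE coframe_frame.
have /colP/(_ a) := TB _ (smooth_frame b) _ Dp.
rewrite [LHS]mxE [RHS]mxE => ->; rewrite (bigD1 b) //= cE eqxx mulr1.
by rewrite big1 ?addr0 // => c cb; rewrite cE (negbTE cb) mulr0.
Qed.

Definition divergence q : R := \sum_h d_xdot h (F_comp F h) q.

Lemma smooth_divergence : smooth_on D divergence.
Proof.
move=> k; apply: C_on_sum => // h.
exact: smooth_d_xdot (smooth_F_comp h) k.
Qed.

(** The 1-form beta = g dt + sum_j (dg/dxdot^j) omega^j, which is minus
    twice the trace of A. *)
Definition trace_form q y : R :=
  divergence q * y.1.1 + \sum_j d_xdot j divergence q * omega j q y.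

(** The trace contains the derivatives d/dxdot^h d/dxdot^j F^h; exchanging
    them produces dg/dxdot^j. *)
Lemma mxtrace_conn_mx p y : D p -> \tr (conn_mx F p y) = - 2^-1 * trace_form p y.
Proof.
move=> Dp; rewrite /mxtrace.
rewrite (eq_bigr (fun h => - 2^-1 * (d_xdot h (F_comp F h) p * y.1.1) +
   - 2^-1 * \sum_j omega j p y * d_xdot h (d_xdot j (F_comp F h)) p)); last first.
  by move=> h _; rewrite mxE mulrDr opprD !mulNr.
rewrite big_split /= -!mulr_sumr -mulrDr; congr (_ * _).
rewrite /trace_form -mulr_suml; congr (_ + _).
rewrite exchange_big; apply: eq_bigr => j _; rewrite -mulr_sumr mulrC; congr (_ * _).
rewrite -[RHS]/('D_((0, 0, ev j) : E1) (fun q => \sum_h d_xdot h (F_comp F h) q) p).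
rewrite derive_sum_seq => [|h]; last first.
  exact: C_on_derivable (smooth_d_xdot h (smooth_F_comp h) 1) Dp.
by apply: eq_bigr => h _; apply: derive_swap oD Dp (smooth_F_comp h 2).
Qed.

Lemma smooth_trace_form Z : smooth_on D Z -> smooth_on D (fun q => trace_form q (Z q)).
Proof.
move=> sZ k; apply: C_onD => //.
  apply: C_onM => //; first exact: smooth_divergence.
  by do 2!apply: C_on_fst => //; exact: sZ.
apply: C_on_sum => // j; apply: C_onM => //; last exact: smooth_omega.
exact: smooth_d_xdot smooth_divergence k.
Qed.

(** The commutator drops out, leaving the exterior derivative of the trace
    of A. *)
Lemma mxtrace_curvature_form X Y p : smooth_on D X -> smooth_on D Y -> D p ->
  \tr (curvature_form X Y p) = - 2^-1 *
    ('D_(X p) (fun q => trace_form q (Y q)) p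
     - 'D_(Y p) (fun q => trace_form q (X q)) p
     - trace_form p (lie_bracket X Y p)).
Proof.
move=> sX sY Dp; rewrite /curvature_form.
have trB (A B : 'M[R]_n) : \tr (A - B) = \tr A - \tr B by exact: raddfB.
have trD (A B : 'M[R]_n) : \tr (A + B) = \tr A + \tr B by exact: raddfD.
rewrite trB trD !trB [X in _ - X]mxtrace_mulC addrK.
have st Z v : smooth_on D Z -> \tr ('D_v (fun q => conn_mx F q (Z q)) p) =
    - 2^-1 * 'D_v (fun q => trace_form q (Z q)) p.
  move=> sZ; rewrite -derive_mxtrace //; last exact: smooth_conn_mx.
  rewrite (derive_eq_on v oD Dp (g := fun q => - 2^-1 * trace_form q (Z q))); last first.
    by move=> q Dq; exact: mxtrace_conn_mx.
  exact: deriveMl (C_on_derivable (smooth_trace_form sZ 1) Dp).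
by rewrite !st // mxtrace_conn_mx // !mulrBr.
Qed.

End Curvature.

(** * Consequences of the divergence equation; parallel volume forms *)

Section DivergenceEquation.
Context {R : realType} {n : nat}.
Local Notation E0 := (R * 'rV[R]_n)%type.
Local Notation E1 := (R * 'rV[R]_n * 'rV[R]_n)%type.
Local Notation ev i := (delta_mx 0 i : 'rV[R]_n).
Local Notation N := (1 + (n + n))%N.
Variables (F : E1 -> 'rV[R]_n) (D0 : set E0) (D : set E1).
(* D is an open part of the jet manifold lying over D0 *)
Hypotheses (oD0 : open D0) (oD : open D) (DD0 : forall p, D p -> D0 p.1).
Hypothesis sF : smooth_on D F.
Implicit Types (p q y u v w : E1) (X Y Z : E1 -> E1).

Lemma trace_form_linear p (c : R) u v :
  trace_form F p (c *: u + v) = c * trace_form F p u + trace_form F p v.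
Proof.
rewrite /trace_form -[(c *: u + v).1.1]/(c * u.1.1 + v.1.1).
rewrite (eq_bigr (fun j => c * (d_xdot j (divergence F) p * omega j p u) +
  d_xdot j (divergence F) p * omega j p v)); last first.
  by move=> j _; rewrite omega_linear; ring.
by rewrite big_split -mulr_sumr /=; ring.
Qed.

Lemma base_expand (w : E0) :
  w = w.1 *: ((1, 0) : E0) + \sum_j w.2 0 j *: ((0, ev j) : E0).
Proof.
have e1 (s : 'I_n -> E0) : (\sum_i s i).1 = \sum_i (s i).1.
  exact: (big_morph (fun e : E0 => e.1) (fun _ _ => erefl) erefl).
have e2 (s : 'I_n -> E0) : (\sum_i s i).2 = \sum_i (s i).2.
  exact: (big_morph (fun e : E0 => e.2) (fun _ _ => erefl) erefl).
have ext (a b : E0) : a.1 = b.1 -> a.2 = b.2 -> a = b.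
  by case: a b => [? ?] [? ?] /= -> ->.
apply: ext.
  rewrite -[RHS]/(w.1 * 1 + (\sum_i _).1) e1 mulr1 big1 ?addr0 // => i _.
  exact: mulr0.
rewrite -[RHS]/(w.1 *: 0 + (\sum_i _).2) e2 scaler0 add0r.
exact: row_sum_delta.
Qed.

Lemma derive_base (f : E0 -> R) (q w : E0) : C_on 1 D0 f -> D0 q ->
  'D_w f q = w.1 * 'D_((1, 0) : E0) f q + \sum_j 'D_((0, ev j) : E0) f q * w.2 0 j.
Proof.
move=> Cf Dq; rewrite {1}(base_expand w) (derive_is_linear _ _ _ oD0 Cf Dq).
congr (_ + _); rewrite (derive_expand oD0 Cf Dq erefl).
by apply: eq_bigr => j _; exact: mulrC.
Qed.

Lemma C_on_base k (W : normedModType R) {fW : finite_dim W} (g : E0 -> W) :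
  C_on k D0 g -> C_on k D (fun p => g p.1).
Proof.
move=> Cg; apply: (C_on_comp (D' := D0)) => //.
by apply: C_on_fst => //; exact: C_on_id.
Qed.

Lemma derive_base_comp (g : E0 -> R) p v : C_on 1 D0 g -> D p ->
  'D_v (fun p : E1 => g p.1) p = 'D_(v.1) g p.1.
Proof.
move=> Cg Dp.
have Cfst : C_on 1 D (fst : E1 -> E0) := C_on_fst oD (C_on_id 1 D).
rewrite (derive_comp v oD oD0 Cfst Cg Dp (DD0 Dp)); congr ('D__ g p.1).
rewrite (derive_linear_comp (L := fst) (f := id)) ?derive_id //.
by move=> x; exact: cvg_fst.
Qed.

Variable f : E0 -> R.
Hypothesis sf : smooth_on D0 f.

(** The right-hand side of the equation is affine in xdot with coefficients
    on M^0, so differentiating it in xdot^j yields df/dx^j; the terms in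
    xdot of beta then cancel. *)
Lemma trace_form_exact : divergence_equation_on F f D ->
  forall p y, D p -> trace_form F p y = 'D_(y.1) f p.1.
Proof.
move=> eqf p y Dp.
have Cd (w : E0) : C_on 1 D0 ('D_w f) := C_on_derive w (sf 2).
have dj j : d_xdot j (divergence F) p = 'D_((0, ev j) : E0) f p.1.
  rewrite /d_xdot (derive_eq_on _ oD Dp eqf).
  have Cc k i : C_on k D (fun q : E1 => q.2 0 i : R).
    by apply: C_on_coord => //; apply: C_on_snd => //; exact: C_on_id.
  have dc i : 'D_((0, 0, ev j) : E1) (fun q : E1 => q.2 0 i : R) p = (i == j)%:R.
    have lin : linear (fun q : E1 => q.2 0 i : R).
      by move=> a u v; rewrite -[(_ + _).2]/(a *: u.2 + v.2) !mxE.
    pose L : {linear E1 -> R} := HB.pack (fun q : E1 => q.2 0 i : R)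
      (GRing.isLinear.Build _ _ _ _ _ lin).
    rewrite (derive_linear_comp (L := L) (f := id)) ?derive_id //.
      by rewrite /= mxE eqxx.
    exact: finite_dim_continuous.
  have Cp i : C_on 1 D (fun q : E1 => 'D_((0, ev i) : E0) f q.1 *: q.2 0 i).
    exact: C_onM oD (C_on_base (Cd _)) (Cc _ _).
  rewrite deriveD; first last.
  - exact: C_on_derivable (C_on_sum _ oD Cp) Dp.
  - exact: C_on_derivable (C_on_base (Cd _)) Dp.
  rewrite (derive_base_comp _ (Cd _) Dp) derive0 add0r.
  rewrite derive_sum_seq => [|i]; last exact: C_on_derivable (Cp i) Dp.
  rewrite (eq_bigr (fun i => 'D_((0, ev i) : E0) f p.1 * (i == j)%:R)).
    exact: sum_mul_delta.
  move=> i _; rewrite (derive_scale _ oD Dp (C_on_base (Cd _)) (Cc 1%N i)) dc.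
  rewrite (derive_base_comp _ (Cd _) Dp) derive0 scale0r add0r.
  by [].
rewrite /trace_form [divergence F p](eqf p Dp) [RHS](derive_base _ (sf 1) (DD0 Dp)).
rewrite mulrDl -addrA; congr (_ + _); first exact: mulrC.
rewrite mulr_suml -big_split /=; apply: eq_bigr => j _.
by rewrite dj /omega; ring.
Qed.

(** beta = df, and d (df) = 0 is the bracket identity for f. *)
Lemma traceless_curvature X Y : divergence_equation_on F f D ->
  smooth_on D X -> smooth_on D Y -> traceless_on F D (curvature F X Y).
Proof.
move=> eqf sX sY; exists (curvature_form F X Y); split.
- exact: smooth_curvature_form.
- exact: curvature_acts_as.
move=> p Dp; rewrite (mxtrace_curvature_form oD sF sX sY Dp).
have Cg k : C_on k D (fun q : E1 => f q.1) by apply: C_on_base; exact: sf.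
have tE Z q : D q -> trace_form F q (Z q) = 'D_(Z q) (fun q : E1 => f q.1) q.
  by move=> Dq; rewrite (trace_form_exact eqf) // (derive_base_comp _ (sf 1) Dq).
rewrite (derive_eq_on _ oD Dp (tE Y)) (derive_eq_on _ oD Dp (tE X)) tE //.
have -> := derive_bracket oD Dp (sX 1) (sY 1) (Cg 2%N).
by rewrite subrr mulr0.
Qed.

Lemma derive_expR_comp (k : E1 -> R) p v : C_on 1 D k -> D p ->
  'D_v (fun q => expR (k q)) p = expR (k p) * 'D_v k p.
Proof.
move=> Ck Dp; have dk : differentiable k p by exact: C_on_differentiable Ck Dp.
have [/derivable1_diffP de eE] := is_derive_expR (k p).
rewrite -[LHS]/('D_v (expR \o k) p) deriveE; last exact: differentiable_comp.
rewrite diff_comp // [LHS]/= -(deriveE v dk) -[X in 'd _ _ X]mulr1.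
by rewrite linearZZ -deriveE // eE; exact: mulrC.
Qed.

Lemma derivable_expR_comp (k : E1 -> R) p v : C_on 1 D k -> D p ->
  derivable (fun q => expR (k q)) p v.
Proof.
move=> Ck Dp; have dk : differentiable k p by exact: C_on_differentiable Ck Dp.
have [/derivable1_diffP de eE] := is_derive_expR (k p).
by apply: diff_derivable; exact: (differentiable_comp dk de).
Qed.

(** The derivative of the determinant of the components cancels against the
    first-order part of nabla_Y, and tr diag (0, A, A) = - beta. *)
Lemma nabla_volumeE Y (Z : 'I_N -> E1 -> E1) p :
  smooth_on D Y -> (forall b, smooth_on D (Z b)) -> D p ->
  nabla_volume F f Y Z p =
  expR (- f p.1) * \det (\matrix_(a, b) coframe F a p (Z b p)) *
    (trace_form F p (Y p) - 'D_((Y p).1) f p.1).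
Proof.
move=> sY sZ Dp.
pose A q : 'M[R]_N := \matrix_(a, b) coframe F a q (Z b q).
have sA k : C_on k D A.
  apply: C_on_mx => // a b.
  rewrite (_ : (fun q => _) = fun q => coframe F a q (Z b q)); last first.
    by apply/funext => q; rewrite mxE.
  exact: smooth_coframe.
have Cf k : C_on k D (fun q : E1 => - f q.1).
  have C1 : C_on k D (fun q : E1 => - 1 * f q.1).
    by apply: C_onM => //; [exact: C_on_cst|apply: C_on_base; exact: sf].
  by apply: C_on_eq C1 => // q _; rewrite mulN1r.
have dfE : 'D_(Y p) (fun q : E1 => - f q.1) p = - 'D_((Y p).1) f p.1.
  rewrite deriveN; first by rewrite (derive_base_comp _ (sf 1) Dp).
  exact: C_on_derivable (C_on_base (sf 1)) Dp.
have dA : 'D_(Y p) (fun q => expR (- f q.1) * \det (A q)) p =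
   expR (- f p.1) * \tr (\adj (A p) *m 'D_(Y p) A p)
   - expR (- f p.1) * 'D_((Y p).1) f p.1 * \det (A p).
  rewrite deriveM; first last.
  - exact: C_on_derivable (C_on_det oD (sA 1%N)) Dp.
  - exact: derivable_expR_comp (Cf 1%N) Dp.
  rewrite (derive_det _ oD Dp (sA 1%N)) (derive_expR_comp _ (Cf 1%N) Dp) dfE.
  congr (_ + _); rewrite -[LHS]/(_ * _); ring.
have sE : \sum_a volume F f p (fun b => if b == a then nabla F Y (Z b) p else Z b p) =
    expR (- f p.1) * (\tr (\adj (A p) *m 'D_(Y p) A p) - trace_form F p (Y p) * \det (A p)).
  rewrite -mulr_sumr; congr (_ * _).
  (* column j of B holds the components of nabla_Y Z_j *)
  pose B := 'D_(Y p) A p + gl_embed (conn_mx F p (Y p)) *m A p.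
  transitivity (\sum_b \det (\matrix_(i, j) if j == b then B i j else A p i j)).
    apply: eq_bigr => b _; congr (\det _); apply/matrixP => i j.
    rewrite mxE [RHS]mxE; case: eqP => _; last by rewrite mxE.
    transitivity (comps F (nabla F Y (Z j)) p i 0); first by rewrite mxE.
    rewrite (comps_nabla_on oD sF Y (sZ j) Dp) mxE [RHS]mxE; congr (_ + _).
      rewrite !derive_entry.
      - by congr ('D__ _ _); apply/funext => q; rewrite !mxE.
      - exact: C_on_derivable (sA 1%N) Dp.
      - exact: C_on_derivable (smooth_comps oD sF (sZ j) 1) Dp.
    rewrite mxE [RHS]mxE; apply: eq_bigr => k _; congr (_ * _).
    by rewrite mxE [RHS]mxE.
  rewrite sum_det_replace_col /B mulmxDr mxtraceD; congr (_ + _).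
  rewrite mulmxA mxtrace_mulC mulmxA mul_mx_adj mul_scalar_mx mxtraceZ.
  rewrite mxtrace_gl_embed (mxtrace_conn_mx oD sF _ Dp) mulrC -mulNr.
  by congr (_ * _); field.
by rewrite /nabla_volume -/(A p) sE dA; ring.
Qed.

(** Evaluation on the adapted frame, where the determinant is 1, and along
    X^sigma, where every omega^j vanishes, recovers the equation from
    parallelism. *)
Lemma volume_parallelP :
  divergence_equation_on F f D <-> parallel_volume_on F f D.
Proof.
split=> [eqf Y Z sY sZ p Dp|par p Dp].
  by rewrite nabla_volumeE // (trace_form_exact eqf) // subrr mulr0.
have sX : smooth_on D (X_sigma F).
  rewrite (_ : X_sigma F = frame F i_time); first exact: smooth_frame.
  by apply/funext => q; rewrite frame_time.
have := par _ _ sX (smooth_frame oD sF) _ Dp.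
rewrite nabla_volumeE //; last exact: smooth_frame.
have -> : \matrix_(a, b) coframe F a p (frame F b p) = 1%:M :> 'M[R]_N.
  by apply/matrixP => a b; rewrite !mxE coframe_frame.
rewrite det1 mulr1 => /eqP; rewrite mulf_eq0 gt_eqF ?expR_gt0 //= subr_eq0 => /eqP.
rewrite (derive_base _ (sf 1) (DD0 Dp)) /trace_form /= mul1r mulr1 big1 ?addr0 // => j _.
by rewrite /omega /= mulr1 subrr mulr0.
Qed.

End DivergenceEquation.

(** * From a closed trace form to a solution *)

Section ClosedTraceForm.
Context {R : realType} {n : nat}.
Local Notation E0 := (R * 'rV[R]_n)%type.
Local Notation E1 := (R * 'rV[R]_n * 'rV[R]_n)%type.
Local Notation ev i := (delta_mx 0 i : 'rV[R]_n).
Variables (F : E1 -> 'rV[R]_n) (D : set E1).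
Hypotheses (oD : open D) (sF : smooth_on D F).
Implicit Types (p v w : E1).

Lemma trace_formZ p (c : R) v : trace_form F p (c *: v) = c * trace_form F p v.
Proof.
have t0 : trace_form F p 0 = 0.
  have := trace_form_linear F p 1 0 0; rewrite scaler0 addr0 mul1r => /eqP.
  by rewrite -subr_eq0 opprD addrA subrr sub0r oppr_eq0 => /eqP.
by rewrite -[c *: v]addr0 trace_form_linear t0 addr0.
Qed.

Lemma derive_scale_direction (W : normedModType R) {fW : finite_dim W}
    (g : E1 -> W) p (c : R) v : C_on 1 D g -> D p ->
  'D_(c *: v) g p = c *: 'D_v g p.
Proof.
by move=> Cg Dp; rewrite -[c *: v]addr0 (derive_is_linear _ _ _ oD Cg Dp) derive0 addr0.
Qed.

Lemma smooth_cst (W : normedModType R) (c : W) : smooth_on D (fun=> c).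
Proof. by move=> k; exact: C_on_cst. Qed.

Lemma smooth_scaled (phi : E1 -> R) v : smooth_on D phi ->
  smooth_on D (fun q => phi q *: v).
Proof. by move=> sphi k; exact: C_onZ oD (sphi k) (C_on_cst k D v). Qed.

(** Tensoriality of the curvature: derivatives of phi cancel against those
    in the bracket, and the constant fields v and w commute. *)
Lemma mxtrace_curvature_scaled (phi : E1 -> R) v w p : smooth_on D phi -> D p ->
  \tr (curvature_form F (fun q => phi q *: v) (fun q => phi q *: w) p) =
  - 2^-1 * (phi p ^+ 2 * ('D_v (fun q => trace_form F q w) p
                          - 'D_w (fun q => trace_form F q v) p)).
Proof.
move=> sphi Dp.
rewrite (mxtrace_curvature_form oD sF (smooth_scaled v sphi) (smooth_scaled w sphi) Dp).
congr (_ * _).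
have st (u : E1) : C_on 1 D (fun q => trace_form F q u).
  exact: (smooth_trace_form oD sF (smooth_cst u) 1%N).
have dt (u u' : E1) : 'D_(phi p *: u) (fun q => trace_form F q (phi q *: u')) p =
    phi p * ('D_u phi p * trace_form F p u' + phi p * 'D_u (fun q => trace_form F q u') p).
  have -> : (fun q => trace_form F q (phi q *: u')) = (fun q => phi q *: trace_form F q u').
    by apply/funext => q; rewrite trace_formZ.
  rewrite (derive_scale_direction _ _ (C_onZ oD (sphi 1%N) (st u')) Dp).
  by rewrite (derive_scale _ oD Dp (sphi 1%N) (st u')).
have db (u u' : E1) : 'D_(phi p *: u) (fun q => phi q *: u') p = (phi p * 'D_u phi p) *: u'.
  rewrite (derive_scale_direction _ _ (smooth_scaled u' sphi 1%N) Dp).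
  rewrite (derive_scale (f := fun=> u') _ oD Dp (sphi 1%N) (C_on_cst 1 D _)).
  by rewrite derive_cst scaler0 addr0 scalerA.
rewrite !dt /lie_bracket !db -(scaleNr _ v) trace_form_linear trace_formZ.
move: ('D_v phi p) ('D_w phi p) (trace_form F p w) (trace_form F p v) => a b c d.
move: ('D_v _ p) ('D_w _ p) (phi p) => e1 e2 e; ring.
Qed.

Lemma trace_form_ver p (y : 'rV[R]_n) : trace_form F p (0, 0, y) = 0.
Proof.
rewrite /trace_form [X in X + _](mulr0 (divergence F p)) add0r big1 // => j _.
have -> : omega j p (0, 0, y) = 0 by rewrite /omega /= mulr0 subr0 mxE.
exact: mulr0.
Qed.

Lemma trace_form_base p j : trace_form F p (0, ev j, 0) = d_xdot j (divergence F) p.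
Proof.
have oE i : omega i p (0, ev j, 0) = (i == j)%:R.
  by rewrite /omega /= mulr0 subr0 mxE eqxx.
rewrite /trace_form [X in X + _](mulr0 (divergence F p)) add0r.
rewrite (eq_bigr (fun i => d_xdot i (divergence F) p * (i == j)%:R)); last first.
  by move=> i _; rewrite oE.
exact: sum_mul_delta.
Qed.

Hypothesis closed : forall v w p, D p ->
  'D_v (fun q => trace_form F q w) p = 'D_w (fun q => trace_form F q v) p.

Lemma ver_expand (y : 'rV[R]_n) :
  ((0, 0, y) : E1) = \sum_j y 0 j *: ((0, 0, ev j) : E1).
Proof.
have e1 (s : 'I_n -> E1) : (\sum_i s i).1 = \sum_i (s i).1.
  exact: (big_morph (fun e : E1 => e.1) (fun _ _ => erefl) erefl).
have e2 (s : 'I_n -> E1) : (\sum_i s i).2 = \sum_i (s i).2.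
  exact: (big_morph (fun e : E1 => e.2) (fun _ _ => erefl) erefl).
have ext (a b : E1) : a.1 = b.1 -> a.2 = b.2 -> a = b.
  by case: a b => [? ?] [? ?] /= -> ->.
apply: ext; last by rewrite e2; exact: row_sum_delta.
by rewrite e1 big1 // => i _; exact: scaler0.
Qed.

(** beta vanishes on vertical vectors, so closedness on a vertical vector
    and d/dx^j says that dg/dxdot^j has no vertical derivative. *)
Lemma derive_ver_d_xdot j p (y : 'rV[R]_n) : D p ->
  'D_((0, 0, y) : E1) (d_xdot j (divergence F)) p = 0.
Proof.
move=> Dp; have := closed (0, 0, y) (0, ev j, 0) Dp.
have -> : (fun q => trace_form F q (0, ev j, 0)) = d_xdot j (divergence F).
  by apply/funext => q; rewrite trace_form_base.
have -> : (fun q => trace_form F q (0, 0, y)) = fun=> 0.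
  by apply/funext => q; rewrite trace_form_ver.
by rewrite derive_cst.
Qed.

Variable D0 : set E0.
Hypotheses (oD0 : open D0) (starD0 : star_shaped D0).
Hypothesis D0D : forall (q : E0) (y : 'rV[R]_n), D0 q -> D (q, y).
Hypothesis DD0 : forall p, D p -> D0 p.1.

(** The fibres are whole vector spaces: the mean value theorem applies on
    the segment from (q, 0) to (q, y), where each dg/dxdot^j is constant. *)
Lemma divergence_affine (q : E0) (y : 'rV[R]_n) : D0 q ->
  divergence F (q, y) = divergence F (q, 0) +
    \sum_j d_xdot j (divergence F) (q, 0) * y 0 j.
Proof.
move=> Dq.
have sg := smooth_divergence oD sF.
have lineE (s : R) : s *: ((0, 0, y) : E1) + (q, 0) = (q, s *: y).
  rewrite -[LHS]/(s *: 0 + q.1, s *: 0 + q.2, s *: y + 0) !scaler0 !add0r addr0.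
  by case: (q).
have Dline (s : R) : D (s *: ((0, 0, y) : E1) + (q, 0)) by rewrite lineE; exact: D0D.
have gj j (s : R) : d_xdot j (divergence F) (q, s *: y) = d_xdot j (divergence F) (q, 0).
  have sd := smooth_d_xdot j sg.
  have [t _|t _] := @mean_value_line _ _ (d_xdot j (divergence F)) (q, 0) (0, 0, y) s.
    exact: C_on_derivable (sd 1%N) (Dline _).
  rewrite (derive_ver_d_xdot j y (Dline (t * s))) mulr0 lineE; exact: subr0_eq.
have [t _|t _] := @mean_value_line _ _ (divergence F) (q, 0) (0, 0, y) 1.
  exact: C_on_derivable (sg 1%N) (Dline _).
rewrite mul1r mulr1 (derive_expand oD (sg 1%N) (Dline t) (ver_expand y)) !lineE.
rewrite scale1r => gE; rewrite -[LHS](subrK (divergence F (q, 0))) gE addrC.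
congr (_ + _).
by apply: eq_bigr => j _; rewrite -(gj j t); exact: mulrC.
Qed.

(** Restricting beta to the zero section xdot = 0 gives a closed 1-form on
    D0, and its primitive solves the equation because g is affine in xdot. *)
Lemma divergence_equation_solvable :
  exists2 f : E0 -> R, smooth_on D0 f & divergence_equation_on F f D.
Proof.
pose z (q : E0) : E1 := (q, 0).
have Cz k : C_on k D0 z by exact: C_on_pair oD0 (C_on_id k D0) (C_on_cst k D0 0).
have Dz q : D0 q -> D (z q) by move=> Dq; exact: D0D.
have dz q (v : E0) : 'D_v z q = (v, 0).
  have lin : linear z.
    by move=> a u u'; rewrite -[RHS]/(_, a *: 0 + 0) scaler0 addr0.
  pose L : {linear E0 -> E1} := HB.pack z (GRing.isLinear.Build _ _ _ _ _ lin).
  rewrite (derive_linear_comp (L := L) (f := id)) ?derive_id //.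
  exact: finite_dim_continuous.
pose alpha (q u : E0) := trace_form F (z q) (u, 0).
have st (u : E1) k : C_on k D (fun p => trace_form F p u).
  exact: (smooth_trace_form oD sF (smooth_cst u) k).
have da (u v q : E0) : D0 q ->
    'D_v (alpha ^~ u) q = 'D_((v, 0) : E1) (fun p => trace_form F p (u, 0)) (z q).
  move=> Dq; rewrite -(dz q v).
  exact: (derive_comp v oD0 oD (Cz 1%N) (st (u, 0) 1%N) Dq (Dz _ Dq)).
have [f sf df] : exists2 f : E0 -> R, smooth_on D0 f &
    forall q u, D0 q -> 'D_u f q = alpha q u.
  apply: poincare => //.
  - move=> q a u v; rewrite /alpha -trace_form_linear; congr trace_form.
    by rewrite -[RHS]/(_, a *: 0 + 0) scaler0 addr0.
  - by move=> u k; exact: (C_on_comp oD0 oD Dz (Cz k) (st (u, 0) k)).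
  - by move=> u v q Dq; rewrite !da //; exact: closed (Dz _ Dq).
exists f => // -[q y] Dp; have Dq : D0 q := DD0 Dp.
rewrite -/(divergence F (q, y)) divergence_affine // !df //; congr (_ + _).
  rewrite /alpha /trace_form /= mulr1 big1 ?addr0 // => j _.
  by rewrite /omega /= !mxE mul0r subr0 mulr0.
by apply: eq_bigr => j _; rewrite df // /alpha trace_form_base.
Qed.

End ClosedTraceForm.

(** * Vector fields on the jet manifold with prescribed support *)

Section GlobalFields.
Context {R : realType} {n : nat} {M : topologicalType}.
Local Notation E0 := (R * 'rV[R]_n)%type.
Local Notation E1 := (R * 'rV[R]_n * 'rV[R]_n)%type.
Implicit Types (c d e : chart R n M) (U : set M) (p q v w : E1).

Lemma chart_image_point c U (y : 'rV[R]_n) : U `<=` chart_dom c ->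
  (chart_coord c @` U) y -> U (chart_param c y) /\ chart_coord c (chart_param c y) = y.
Proof. by move=> Uc [x Ux <-]; rewrite coordK //; exact: Uc. Qed.

(** Inside the image of the chart it is the preimage of U under the
    parametrization. *)
Lemma open_chart_image c U : open U -> U `<=` chart_dom c ->
  open (chart_coord c @` U).
Proof.
move=> oU Uc; rewrite openE => y Uy; rewrite /interior.
have [Up yE] := chart_image_point Uc Uy.
have iy : (chart_coord c @` chart_dom c) y by exists (chart_param c y) => //; exact: Uc.
have n1 : nbhs y (chart_coord c @` chart_dom c).
  by apply: open_nbhs_nbhs; split => //; exact: img_open.
have n2 : nbhs y (chart_param c @^-1` U).
  by apply: (param_cont iy); exact: open_nbhs_nbhs.
apply: filterS2 n1 n2 => z [x cx <-]; rewrite /= coordK // => Ux.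
by exists x.
Qed.

Lemma open_dom0 c U : open U -> U `<=` chart_dom c -> open (dom0 c U : set E0).
Proof.
move=> oU Uc; apply: (@open_comp _ _ (snd : E0 -> 'rV[R]_n) _ _ (open_chart_image oU Uc)).
by move=> q _; exact: cvg_snd.
Qed.

Lemma open_dom1 c U : open U -> U `<=` chart_dom c -> open (dom1 c U : set E1).
Proof.
move=> oU Uc.
apply: (@open_comp _ _ (fun p : E1 => p.1.2) _ _ (open_chart_image oU Uc)).
move=> q _; apply: (@continuous_comp _ _ _ (fst : E1 -> E0) (snd : E0 -> 'rV[R]_n)).
  exact: cvg_fst.
exact: cvg_snd.
Qed.

Lemma transition_coord c d x : chart_dom c x ->
  transition c d (chart_coord c x) = chart_coord d x.
Proof. by move=> cx; rewrite /transition /= coordK. Qed.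

Variable A : set (chart R n M).
Hypothesis atlas : analytic_atlas A.

Lemma transition_smooth c d : A c -> A d ->
  smooth_on (chart_coord c @` (chart_dom c `&` chart_dom d)) (transition c d).
Proof. by case: atlas => _ h Ac Ad; have [] := h c d Ac Ad. Qed.

Lemma open_overlap c d : open (chart_coord c @` (chart_dom c `&` chart_dom d)).
Proof.
apply: open_chart_image; last by move=> x [].
by apply: openI; exact: dom_open.
Qed.

Lemma open_dom1_overlap c d : open (dom1 c (chart_dom c `&` chart_dom d) : set E1).
Proof.
apply: open_dom1; last by move=> x [].
by apply: openI; exact: dom_open.
Qed.

(** Chain rule for the cocycle identity, which holds on the open triple
    overlap. *)
Lemma derive_transition_comp c d e x (v : 'rV[R]_n) : A c -> A d -> A e ->
  chart_dom c x -> chart_dom d x -> chart_dom e x ->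
  'D_('D_v (transition c d) (chart_coord c x)) (transition d e) (chart_coord d x) =
  'D_v (transition c e) (chart_coord c x).
Proof.
move=> Ac Ad Ae cx dx ex.
pose U := chart_dom c `&` chart_dom d `&` chart_dom e.
have oU : open U by apply: openI; [apply: openI|]; exact: dom_open.
have Uc : U `<=` chart_dom c by move=> y [[]].
have oD : open (chart_coord c @` U) by exact: open_chart_image.
have Dx : (chart_coord c @` U) (chart_coord c x) by exists x.
have C1 : C_on 1 (chart_coord c @` U) (transition c d).
  apply: C_on_sub (transition_smooth Ac Ad 1%N) => _ [y [[cy dy] _] <-].
  by exists y.
have C2 := transition_smooth Ad Ae 1%N.
have im : (chart_coord d @` (chart_dom d `&` chart_dom e))
    (transition c d (chart_coord c x)).
  by rewrite transition_coord //; exists x.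
have H := derive_comp v oD (@open_overlap d e) C1 C2 Dx im.
rewrite transition_coord // in H; rewrite -H.
apply: (derive_eq_on _ oD Dx) => _ [y [[cy dy] ey] <-].
by rewrite !transition_coord.
Qed.

Lemma transition1E c d t x (v : 'rV[R]_n) : chart_dom c x ->
  transition1 c d (t, chart_coord c x, v) =
  (t, chart_coord d x, 'D_v (transition c d) (chart_coord c x)).
Proof. by move=> cx; rewrite /transition1 /= transition_coord. Qed.

Lemma transition1_comp c d e t x (v : 'rV[R]_n) : A c -> A d -> A e ->
  chart_dom c x -> chart_dom d x -> chart_dom e x ->
  transition1 d e (transition1 c d (t, chart_coord c x, v)) =
  transition1 c e (t, chart_coord c x, v).
Proof.
by move=> Ac Ad Ae cx dx ex; rewrite !transition1E // derive_transition_comp.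
Qed.

Lemma transition1_id c t x (v : 'rV[R]_n) : A c -> chart_dom c x ->
  transition1 c c (t, chart_coord c x, v) = (t, chart_coord c x, v).
Proof.
move=> Ac cx; rewrite transition1E //; congr (_, _).
have oD := open_chart_image (dom_open c) (fun x cx => cx).
have Dx : (chart_coord c @` chart_dom c) (chart_coord c x) by exists x.
rewrite (derive_eq_on _ oD Dx (g := id)) ?derive_id // => _ [y cy <-].
exact: transition_coord.
Qed.

(** Points of M^1 over U are written with an actual point x of M;
    transitions then act by changing the chart applied to x. *)
Lemma dom1_point c U p : U `<=` chart_dom c -> dom1 c U p ->
  exists t x (v : 'rV[R]_n), U x /\ p = (t, chart_coord c x, v).
Proof. by case: p => [[t y] v] Uc [x Ux /= <-]; exists t, x, v. Qed.

Lemma transition1_smooth c d : A c -> A d ->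
  smooth_on (dom1 c (chart_dom c `&` chart_dom d)) (transition1 c d).
Proof.
move=> Ac Ad k; have oD := @open_dom1_overlap c d.
have oO := @open_overlap c d; have sT := transition_smooth Ac Ad.
set D := dom1 _ _ in oD *.
have Cfst : C_on k D (fun p => p.1) by apply: C_on_fst => //; exact: C_on_id.
have Cx : C_on k D (fun p => p.1.2) by exact: C_on_snd.
have Cv : C_on k D (fun p => p.2) by apply: C_on_snd => //; exact: C_on_id.
apply: C_on_pair => //.
  apply: C_on_pair => //; first exact: C_on_fst.
  exact: (C_on_comp oD oO (fun p Dp => Dp) Cx (sT k)).
have H : C_on k D (fun p => \sum_i p.2 0 i *:
    'D_(delta_mx 0 i : 'rV[R]_n) (transition c d) p.1.2).
  apply: C_on_sum => // i; apply: C_onZ => //; first exact: C_on_coord.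
  exact: (C_on_comp oD oO (fun p Dp => Dp) Cx (C_on_derive _ (sT k.+1))).
apply: C_on_eq H => // p Dp.
exact: esym (derive_expand oO (sT 1%N) Dp (row_sum_delta _)).
Qed.

Lemma transition1_overlap c d p : A c -> A d ->
  dom1 c (chart_dom c `&` chart_dom d) p ->
  dom1 d (chart_dom d `&` chart_dom c) (transition1 c d p).
Proof.
move=> Ac Ad /dom1_point[|t [x [v [[cx dx] ->]]]]; first by move=> x [].
by rewrite transition1E //; exists x.
Qed.

Lemma derive_transition1_comp c d e t x (u : 'rV[R]_n) (v : E1) : A c -> A d -> A e ->
  chart_dom c x -> chart_dom d x -> chart_dom e x ->
  'D_('D_v (transition1 c d) (t, chart_coord c x, u)) (transition1 d e)
    (transition1 c d (t, chart_coord c x, u)) =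
  'D_v (transition1 c e) (t, chart_coord c x, u).
Proof.
move=> Ac Ad Ae cx dx ex.
pose U := chart_dom c `&` chart_dom d `&` chart_dom e.
have oU : open U by apply: openI; [apply: openI|]; exact: dom_open.
have Uc : U `<=` chart_dom c by move=> y [[]].
have oD : open (dom1 c U : set E1) by exact: open_dom1.
have Dx : dom1 c U (t, chart_coord c x, u) by exists x.
have C1 : C_on 1 (dom1 c U) (transition1 c d).
  apply: C_on_sub (transition1_smooth Ac Ad 1%N) => p [y [[cy dy] _] yE].
  by exists y.
have im : dom1 d (chart_dom d `&` chart_dom e)
    (transition1 c d (t, chart_coord c x, u)).
  by rewrite transition1E //; exists x.
have <- := derive_comp v oD (@open_dom1_overlap d e) C1 (transition1_smooth Ad Ae 1%N) Dx im.
apply: (derive_eq_on _ oD Dx) => p /dom1_point[|t' [y [w [[[cy dy] ey] ->]]]] //.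
exact: transition1_comp.
Qed.

Section LocalizedField.
Variables (c0 : chart R n M) (y0 : 'rV[R]_n) (r : R) (v : E1).
Hypotheses (Ac0 : A c0) (r0 : 0 < r) (hausM : hausdorff_space M).
Hypothesis ball_img : forall y : 'rV[R]_n, `|y - y0| <= r ->
  (chart_coord c0 @` chart_dom c0) y.

(** In the chart c0 this is the constant vector v multiplied by a bump
    function of the position x; elsewhere it is the transform of that field,
    extended by zero. *)
Definition localized_field c p : E1 :=
  if `[< chart_dom c0 (chart_param c p.1.2) >] then
    bump y0 r (transition1 c c0 p).1.2 *: 'D_v (transition1 c0 c) (transition1 c c0 p)
  else 0.

Let K : set M := chart_param c0 @` [set y : 'rV[R]_n | `|y - y0| <= r].

(** A compact subset of a Hausdorff space. Closedness is what allows
    extension by zero. *)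
Lemma closed_support : closed K.
Proof.
apply: compact_closed => //; apply: continuous_compact.
  apply: continuous_in_subspaceT => y /set_mem yr.
  by apply: param_cont; exact: ball_img.
apply: bounded_closed_compact.
  exists (`|y0| + r); split; first exact: num_real.
  move=> B hB y yr; apply: le_trans (ltW hB).
  by rewrite -[y](subrK y0) (le_trans (ler_normD _ _)) // addrC lerD2l.
rewrite (_ : [set _ | _] = (fun y : 'rV[R]_n => `|y - y0|) @^-1` [set x | x <= r]) //.
have cr : closed [set x : R | x <= r] by exact: closed_le.
have cn : continuous (fun y : 'rV[R]_n => `|y - y0|); last first.
  by move/continuous_closedP : cn; exact.
have C0 : C_on 0 [set: 'rV[R]_n] (fun y => y - y0).
  exact: C_onD openT (C_on_id 0 _) (C_on_cst 0 _ (- y0)).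
by move=> y; exact: cvg_norm (C_on_continuous C0 I).
Qed.

Lemma localized_field_in c t x (u : 'rV[R]_n) : chart_dom c x -> chart_dom c0 x ->
  localized_field c (t, chart_coord c x, u) =
  bump y0 r (chart_coord c0 x) *:
    'D_v (transition1 c0 c) (transition1 c c0 (t, chart_coord c x, u)).
Proof.
move=> cx c0x; rewrite /localized_field /= coordK // asboolT //.
by rewrite transition_coord.
Qed.

Lemma localized_field_out c t x (u : 'rV[R]_n) : chart_dom c x -> ~ K x ->
  localized_field c (t, chart_coord c x, u) = 0.
Proof.
move=> cx Kx; have [c0x|c0x] := pselect (chart_dom c0 x); last first.
  by rewrite /localized_field /= coordK // asboolF.
rewrite localized_field_in //; have [->|b0] := eqVneq (bump y0 r (chart_coord c0 x)) 0.
  by rewrite scale0r.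
exfalso; apply: Kx; exists (chart_coord c0 x); last exact: coordK.
exact: bump_support b0.
Qed.

Lemma localized_field_center p : dom1 c0 (chart_dom c0) p ->
  localized_field c0 p = bump y0 r p.1.2 *: v.
Proof.
move=> Dp; have [t [x [u [c0x pE]]]] := dom1_point (fun x cx => cx) Dp.
rewrite pE localized_field_in // transition1_id //=; congr (_ *: _).
have oD := open_dom1 (dom_open c0) (fun x cx => cx).
rewrite pE in Dp; rewrite (derive_eq_on _ oD Dp (g := id)) ?derive_id // => q.
move=> /(dom1_point (fun x cx => cx))[t' [x' [u' [c0x' ->]]]].
exact: transition1_id.
Qed.

(** The domain is covered by the overlap with c0, where the defining formula
    is smooth, and the complement of the support, where the field vanishes. *)
Lemma localized_field_smooth c : A c ->
  smooth_on (dom1 c (chart_dom c)) (localized_field c).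
Proof.
move=> Ac k.
pose W1 := dom1 c (chart_dom c `&` chart_dom c0) : set E1.
pose W2 := dom1 c (chart_dom c `&` ~` K) : set E1.
have oW1 : open W1 by exact: open_dom1_overlap.
have oW2 : open W2.
  apply: open_dom1; last by move=> x [].
  apply: openI; first exact: dom_open.
  exact: closed_openC closed_support.
apply: (@C_on_sub _ _ _ _ (W1 `|` W2)).
  move=> p Dp; have [t [x [u [cx ->]]]] := dom1_point (fun x cx => cx) Dp.
  have [Kx|Kx] := pselect (K x); [left|right]; exists x => //; split => //.
  have [y yr <-] := Kx; have [y' cy' <-] := ball_img yr.
  by rewrite coordK.
apply: C_on_setU; last first.
  apply: C_on_eq (C_on_cst k W2 (0 : E1)) => // p.
  move=> /dom1_point[|t [x [u [[cx Kx] ->]]]]; first by move=> x [].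
  by rewrite localized_field_out.
have oO := @open_dom1_overlap c0 c.
have sT : C_on k W1 (transition1 c c0) by exact: transition1_smooth.
have im p : W1 p -> dom1 c0 (chart_dom c0 `&` chart_dom c) (transition1 c c0 p).
  exact: transition1_overlap.
have C1 : C_on k W1 (fun p => bump y0 r (transition1 c c0 p).1.2).
  apply: (C_on_comp oW1 openT _ _ (bump_smooth y0 r k)) => //.
  by apply: C_on_snd => //; exact: C_on_fst.
have C2 : C_on k W1 (fun p => 'D_v (transition1 c0 c) (transition1 c c0 p)).
  exact: (C_on_comp oW1 oO im sT (C_on_derive v (transition1_smooth Ac0 Ac k.+1))).
apply: C_on_eq (C_onZ oW1 C1 C2) => // p.
move=> /dom1_point[|t [x [u [[cx c0x] ->]]]]; first by move=> x [].
by rewrite localized_field_in // /transition1 /= transition_coord.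
Qed.

(** Outside the support both sides vanish; on it the transformation rule is
    the chain rule for the cocycle of transitions. *)
Lemma localized_field_vector : vector_field1 A localized_field.
Proof.
split; first exact: localized_field_smooth.
move=> c d Ac Ad p /dom1_point[|t [x [u [[cx dx] ->]]]]; first by move=> x [].
have [c0x|c0x] := pselect (chart_dom c0 x); last first.
  have Kx : ~ K x.
    move=> [y yr yx]; apply: c0x; rewrite -yx.
    by have [y' cy' <-] := ball_img yr; rewrite coordK.
  by rewrite transition1E // !localized_field_out // derive0.
rewrite [in LHS]transition1E // !localized_field_in // -transition1E //.
rewrite transition1_comp //.
pose D := dom1 c (chart_dom c `&` chart_dom d) : set E1.
have Dp : D (t, chart_coord c x, u) by exists x.
move: (bump _ _ _) => b.
have back : transition1 c0 c (transition1 c c0 (t, chart_coord c x, u)) =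
    (t, chart_coord c x, u) by rewrite transition1_comp // transition1_id.
have scaleE w : 'D_(b *: w) (transition1 c d) (t, chart_coord c x, u) =
    b *: 'D_w (transition1 c d) (t, chart_coord c x, u).
  apply: derive_scale_direction Dp; first exact: open_dom1_overlap.
  exact: transition1_smooth.
have := derive_transition1_comp t ('D_u (transition c c0) (chart_coord c x)) v
  Ac0 Ac Ad c0x cx dx.
rewrite -(transition1E c0 t u cx) back => <-.
exact: esym (scaleE _).
Qed.

End LocalizedField.

End GlobalFields.

(** * The holonomy algebra *)

Section Holonomy.
Context {R : realType} {n : nat} {M : topologicalType}.
Local Notation E0 := (R * 'rV[R]_n)%type.
Local Notation E1 := (R * 'rV[R]_n * 'rV[R]_n)%type.
Implicit Types (c : chart R n M) (U : set M) (p v w : E1).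

Lemma curvature_form_eq_on (F : E1 -> 'rV[R]_n) (D : set E1) (X X' Y Y' : E1 -> E1) p :
  open D -> D p -> (forall q, D q -> X q = X' q) -> (forall q, D q -> Y q = Y' q) ->
  curvature_form F X Y p = curvature_form F X' Y' p.
Proof.
move=> oD Dp XX YY; rewrite /curvature_form /lie_bracket (XX _ Dp) (YY _ Dp).
have H (W : normedModType R) (g g' : E1 -> W) u : (forall q, D q -> g q = g' q) ->
    'D_u g p = 'D_u g' p by move=> gg; exact: derive_eq_on oD Dp gg.
rewrite (H _ _ _ _ XX) (H _ _ _ _ YY).
rewrite (H _ (fun q => conn_mx F q (Y q)) (fun q => conn_mx F q (Y' q))); last first.
  by move=> q Dq; rewrite YY.
rewrite (H _ (fun q => conn_mx F q (X q)) (fun q => conn_mx F q (X' q))) //.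
by move=> q Dq; rewrite XX.
Qed.

Lemma sl_image_sum (I : finType) (a : I -> R) (B : I -> 'M[R]_(1 + (n + n))) :
  (forall i, sl_image (B i)) -> sl_image (\sum_i a i *: B i).
Proof.
move=> sB; elim/big_ind: _ => [|_ _ [L1 t1 <-] [L2 t2 <-]|i _].
- by exists 0; [rewrite /= mxtrace0|rewrite linear0].
- by exists (L1 + L2); [rewrite /= mxtraceD t1 t2 addr0|rewrite gl_embedD].
- have [L tL <-] := sB i; exists (a i *: L); first by rewrite /= mxtraceZ tL mulr0.
  exact: linearZZ.
Qed.

Lemma chart_ball c (y0 : 'rV[R]_n) : (chart_coord c @` chart_dom c) y0 ->
  exists2 r : R, 0 < r & forall y : 'rV[R]_n, `|y - y0| <= r ->
    (chart_coord c @` chart_dom c) y.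
Proof.
move=> Dy; have : nbhs y0 (chart_coord c @` chart_dom c).
  by apply: open_nbhs_nbhs; split => //; exact: img_open.
move=> /nbhs_ballP[e e0 eD]; exists (e / 2); first by rewrite divr_gt0.
move=> y ye; apply: eD; rewrite -ball_normE /ball_ /= distrC.
by apply: le_lt_trans ye _; rewrite ltr_pdivrMr // ltr_pMr // ltr1n.
Qed.

Variables (A : set (chart R n M)) (sigma : jet A 1 -> jet A 2).
Hypotheses (hausM : hausdorff_space M) (atlas : analytic_atlas A).
Hypothesis sigma_smooth : forall c, A c ->
  smooth_on (dom1 c (chart_dom c)) (sode_coord sigma c).

(** The generator without covariant derivatives, formed with two localized
    fields equal to multiples of v and w near p, already forces d beta (v,
    w) = 0 at p. *)
Lemma holonomy_closed c p v w : A c -> dom1 c (chart_dom c) p ->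
  holonomy_algebra sigma c p `<=` sl_image ->
  'D_v (fun q => trace_form (sode_coord sigma c) q w) p =
  'D_w (fun q => trace_form (sode_coord sigma c) q v) p.
Proof.
move=> Ac Dp hol; have sF := sigma_smooth Ac; set F := sode_coord sigma c in sF *.
have oD : open (dom1 c (chart_dom c) : set E1) by apply: open_dom1 => //; exact: dom_open.
have [r r0 rD] := chart_ball Dp.
pose X u := localized_field c p.1.2 r u.
have vX u : vector_field1 A (X u) by exact: localized_field_vector.
have sX u : smooth_on (dom1 c (chart_dom c)) (X u c) by exact: (vX u).1.
pose phi (q : E1) := bump p.1.2 r q.1.2.
have sphi : smooth_on (dom1 c (chart_dom c)) phi.
  move=> k; apply: (C_on_comp oD openT _ _ (bump_smooth p.1.2 r k)) => //.
  by apply: C_on_snd => //; apply: C_on_fst => //; exact: C_on_id.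
have XE u q : dom1 c (chart_dom c) q -> X u c q = phi q *: u.
  by move=> Dq; exact: localized_field_center.
have [L /= L0] : sl_image (end_mx F (curvature F (X v c) (X w c)) p).
  apply: hol; exists 1%N, (fun=> 1), (fun=> end_mx F (curvature F (X v c) (X w c)) p).
  split; last by rewrite big_ord1 scale1r.
  by move=> _; exists [::], (X v), (X w); split.
rewrite (end_mx_acts_as oD sF Dp (curvature_acts_as oD sF (sX v) (sX w))) => LE.
have : \tr (curvature_form F (X v c) (X w c) p) = 0.
  have : \tr (gl_embed (curvature_form F (X v c) (X w c) p)) = 0.
    by rewrite -LE mxtrace_gl_embed L0 addr0.
  by rewrite mxtrace_gl_embed; lra.
rewrite (curvature_form_eq_on F oD Dp (XE v) (XE w)).
rewrite (mxtrace_curvature_scaled oD sF v w sphi Dp).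
move/eqP; rewrite mulf_eq0 oppr_eq0 invr_eq0 pnatr_eq0 /= mulf_eq0 expf_eq0 /=.
by rewrite (negbTE (bump_center _ r0)) /= => /eqP/subr0_eq.
Qed.

(** The primitive found in coordinates is transported to M by the chart; it
    represents f only over U, where chart and parametrization are inverse. *)
Lemma holonomy_divergence_equation c U : A c -> open U -> U `<=` chart_dom c ->
  star_shaped (chart_coord c @` U) ->
  (forall p, dom1 c (chart_dom c) p -> holonomy_algebra sigma c p `<=` sl_image) ->
  exists F : R * M -> R, smooth0_on F c U /\
    divergence_equation_on (sode_coord sigma c) (coord0_fun F c) (dom1 c U).
Proof.
move=> Ac oU Uc [y0 y0U star] hol.
have sub : dom1 c U `<=` (dom1 c (chart_dom c) : set E1).
  by move=> p [x Ux xp]; exists x => //; exact: Uc.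
have sF : smooth_on (dom1 c U) (sode_coord sigma c).
  by move=> k; exact: C_on_sub sub (sigma_smooth Ac k).
have oD0 : open (dom0 c U : set E0) := open_dom0 oU Uc.
have oD : open (dom1 c U : set E1) := open_dom1 oU Uc.
have cl v w p : dom1 c U p ->
    'D_v (fun q => trace_form (sode_coord sigma c) q w) p =
    'D_w (fun q => trace_form (sode_coord sigma c) q v) p.
  by move=> /sub Dp; apply: holonomy_closed => //; exact: hol.
have starD0 : star_shaped (dom0 c U : set E0).
  by exists (0, y0) => // q s Dq s01; exact: star.
have [f sf eqf] := divergence_equation_solvable oD sF cl oD0 starD0
  (fun q y Dq => Dq) (fun p Dp => Dp).
(* chart_coord is the inverse of chart_param on the image of U *)
exists (fun tx => f (tx.1, chart_coord c tx.2)).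
have fE q : dom0 c U q ->
    f q = coord0_fun (fun tx => f (tx.1, chart_coord c tx.2)) c q.
  case: q => t y Dq; rewrite /coord0_fun /=.
  by have [_ ->] := chart_image_point Uc Dq.
split; first by move=> k; exact: C_on_eq fE (sf k).
move=> p Dp; rewrite (eqf p Dp).
have dE (u : E0) : 'D_u f p.1 =
    'D_u (coord0_fun (fun tx => f (tx.1, chart_coord c tx.2)) c) p.1.
  exact: derive_eq_on oD0 Dp fE.
by rewrite dE; congr (_ + _); apply: eq_bigr => i _; rewrite dE.
Qed.

(** A coordinate ball around p is star-shaped, and the generators at p only
    depend on the germs of the fields there. *)
Lemma divergence_equation_holonomy c p : A c -> dom1 c (chart_dom c) p ->
  (forall U, open U -> U `<=` chart_dom c -> star_shaped (chart_coord c @` U) ->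
    exists F : R * M -> R, smooth0_on F c U /\
      divergence_equation_on (sode_coord sigma c) (coord0_fun F c) (dom1 c U)) ->
  holonomy_algebra sigma c p `<=` sl_image.
Proof.
move=> Ac Dp solv; set y0 := p.1.2.
have [r r0 rD] := chart_ball Dp.
pose U := chart_dom c `&` chart_coord c @^-1` ball y0 r.
have Uc : U `<=` chart_dom c by move=> x [].
have imgU (y : 'rV[R]_n) : ball y0 r y -> (chart_coord c @` U) y.
  move=> yr; have [] := rD y.
    by move: yr; rewrite -ball_normE /ball_ /= distrC => /ltW.
  by move=> x cx xy; exists x => //; split => //; rewrite /= xy.
have oU : open U.
  rewrite openE => x [cx xr]; rewrite /interior; apply: filterI.
    by apply: open_nbhs_nbhs; split => //; exact: dom_open.
  apply: (coord_cont cx); apply: open_nbhs_nbhs; split => //.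
  exact: ball_open.
have starU : star_shaped (chart_coord c @` U).
  exists y0; first by apply: imgU; exact: ballxx.
  move=> _ s [x [cx xr] <-] /andP[s0 s1]; apply: imgU; move: xr.
  rewrite -ball_normE /ball_ /= => xr.
  rewrite opprD addrA subrr sub0r normrN normrZ (ger0_norm s0) distrC.
  by apply: le_lt_trans xr; rewrite ler_piMl.
have [F [sf eqf]] := solv U oU Uc starU.
have sub : dom1 c U `<=` (dom1 c (chart_dom c) : set E1).
  by move=> q [x Ux xp]; exists x => //; exact: Uc.
have sF : smooth_on (dom1 c U) (sode_coord sigma c).
  by move=> k; exact: C_on_sub sub (sigma_smooth Ac k).
have oD0 : open (dom0 c U : set E0) := open_dom0 oU Uc.
have oD : open (dom1 c U : set E1) := open_dom1 oU Uc.
have Up : dom1 c U p by apply: imgU; exact: ballxx.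
have sV V : vector_field1 A V -> smooth_on (dom1 c U) (V c).
  by move=> [sV _] k; exact: C_on_sub sub (sV c Ac k).
move=> B [k [a [E [genE ->]]]]; apply: sl_image_sum => i.
have [Vs [X [Y [vVs /sV sX /sV sY ->]]]] := genE i.
have tl := traceless_curvature oD0 oD (fun p Dp => Dp) sF sf eqf sX sY.
have sVs j : (j < size [seq V c | V <- Vs])%N ->
    smooth_on (dom1 c U) (nth (fun=> 0) [seq V c | V <- Vs] j).
  rewrite size_map => jV; rewrite (nth_map (fun _ _ => 0)) //.
  by apply: sV; exact: vVs.
have [L [_ TL L0]] := nabla_curvature_traceless oD sF sVs tl.
by exists (L p); [exact: L0|rewrite (end_mx_acts_as oD sF Up TL)].
Qed.

End Holonomy.

Theorem mainTheorem10 (R : realType) (n : nat) (M : topologicalType)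
    (A : set (chart R n M)) (sigma : jet A 1 -> jet A 2)
    (M_manifold : analytic_manifold A)
    (M_connected : connected [set: M])
    (sigma_analytic : analytic_sode sigma) :
  ((forall (c : chart R n M) (p : R * 'rV[R]_n * 'rV[R]_n),
      A c -> dom1 c (chart_dom c) p -> holonomy_algebra sigma c p `<=` sl_image)
   <->
   (forall (c : chart R n M) (U : set M),
      A c -> open U -> U `<=` chart_dom c -> star_shaped (chart_coord c @` U) ->
      exists F : R * M -> R,
        smooth0_on F c U /\
        divergence_equation_on (sode_coord sigma c) (coord0_fun F c)
          (dom1 c U)))
  /\
  (forall (c : chart R n M) (U : set M) (F : R * M -> R),
     A c -> open U -> U `<=` chart_dom c -> smooth0_on F c U ->
     (divergence_equation_on (sode_coord sigma c) (coord0_fun F c) (dom1 c U)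
      <->
      parallel_volume_on (sode_coord sigma c) (coord0_fun F c) (dom1 c U))).
Proof.
have [hausM _ atlas] := M_manifold.
have sF c : A c -> smooth_on (dom1 c (chart_dom c)) (sode_coord sigma c).
  by move=> Ac; have [_ h] := sigma_analytic; have [] := h c Ac.
split; first split.
- move=> hol c U Ac oU Uc star.
  apply: (holonomy_divergence_equation hausM atlas sF Ac oU Uc star) => p.
  exact: hol.
- move=> solv c p Ac Dp; apply: (divergence_equation_holonomy sF Ac Dp) => U.
  exact: solv.
- move=> c U F Ac oU Uc sf.
  apply: (volume_parallelP (open_dom0 oU Uc) (open_dom1 oU Uc) (fun p Dp => Dp) _ sf).
  move=> k; apply: C_on_sub (sF c Ac k) => p [x Ux xp].
  by exists x => //; exact: Uc.
Qed.
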